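(* The problem $\textsc{EnumClosureMin}_{L_0}$ is equivalent, under polynomial delay reductions (in both directions), to the problem of enumerating the circuits of a binary matroid.
   Context: Boolean vectors in $\{0,1\}^n$ are ordered by $v\le u$ iff $\{i: v_i=1\}\subseteq\{i:u_i=1\}$. $L_0$ is the clone generated by the binary addition $+$ over $\mathbb{F}_2$ (XOR), acting coordinate-wise, so $Cl_{L_0}(\mathcal{S})$ is the smallest set containing $\mathcal{S}$ closed under coordinate-wise XOR. $\textsc{EnumClosureMin}_{L_0}$: given a finite $\mathcal{S}\subseteq\{0,1\}^n$, enumerate without repetition the minimal elements (for $\le$) of $Cl_{L_0}(\mathcal{S})\setminus\{\mathbf{0},\mathbf{1}\}$. A binary matroid is given by a finite family of vectors over $\mathbb{F}_2$; a circuit is an inclusion-minimal subfamily that is linearly dependent; the enumeration problem asks, given the family, to list all its circuits. An enumeration problem maps each input $x$ to a finite set $A(x)$ of outputs. A polynomial delay reduction from $A$ to $B$ consists of a polynomial-time function $f$ and an enumeration problem $C$ solvable with polynomial delay such that for every instance $x$ of $A$: for distinct $y,z\in B(f(x))$, $C(xy)\cap C(xz)=\emptyset$ (where $xy$ is concatenation), and $A(x)=\bigcup_{y\in B(f(x))}C(xy)$. Two problems are equivalent if each reduces to the other. *)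

(* Defs.v *)
From HB Require Import structures.
From mathcomp Require Import all_boot all_order all_algebra.
From mathcomp Require Import finmap.

Set Implicit Arguments.
Unset Strict Implicit.
Unset Printing Implicit Defensive.

Import GRing.Theory.

Definition word := seq bool.

(** * Random access machines

   A register machine with indirect addressing over unbounded natural numbers,
   a read-only input word and an output buffer.  Every instruction costs one
   time unit.  The only arithmetic is addition and truncated subtraction, so
   register values gain at most one bit per step and this unit-cost measure is
   polynomially related to the logarithmic-cost one and to Turing machine
   time.  Output words are written one letter at a time, so that producing a
   word costs at least its length. *)

Inductive instr :=
| Const of nat & nat          (* R_i <- c *)
| Add of nat & nat & nat      (* R_i <- R_j + R_k *)
| Sub of nat & nat & nat      (* R_i <- R_j - R_k, truncated *)
| Fetch of nat & nat          (* R_i <- R_(R_j) *)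
| Store of nat & nat          (* R_(R_i) <- R_j *)
| Read of nat & nat           (* R_i <- letter R_j of the input, 2 past its end *)
| Jz of nat & nat             (* if R_i = 0 then go to instruction l *)
| Write of nat                (* append the bit [R_i != 0] to the buffer *)
| Emit                        (* output the buffer as one word, and empty it *)
| Halt.

Definition program := seq instr.

Record config := Config { pc : nat; reg : nat -> nat; buf : word }.

Definition init_config : config := Config 0 (fun=> 0) [::].

Definition upd (r : nat -> nat) (i a : nat) : nat -> nat :=
  fun j => if j == i then a else r j.

Definition input_letter (x : word) (i : nat) : nat :=
  if i < size x then nat_of_bool (nth false x i) else 2.

(* Leaving the program text halts. *)
Definition current (P : program) (c : config) : instr := nth Halt P (pc c).

Definition step (P : program) (x : word) (c : config) : config :=
  let: Config l r b := c in
  match current P c with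
  | Const i a => Config l.+1 (upd r i a) b
  | Add i j k => Config l.+1 (upd r i (r j + r k)) b
  | Sub i j k => Config l.+1 (upd r i (r j - r k)) b
  | Fetch i j => Config l.+1 (upd r i (r (r j))) b
  | Store i j => Config l.+1 (upd r (r i) (r j)) b
  | Read i j => Config l.+1 (upd r i (input_letter x (r j))) b
  | Jz i l' => Config (if r i == 0 then l' else l.+1) r b
  | Write i => Config l.+1 r (rcons b (r i != 0))
  | Emit => Config l.+1 r [::]
  | Halt => c
  end.

Definition run (P : program) (x : word) (t : nat) : config :=
  iter t (step P x) init_config.

Definition halted (P : program) (c : config) : bool :=
  if current P c is Halt then true else false.

(* The word output by the step from time t to time t + 1, if any. *)
Definition emitted (P : program) (x : word) (t : nat) : option word :=
  if current P (run P x t) is Emit then Some (buf (run P x t)) else None.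

Definition outputs (P : program) (x : word) (T : nat) : seq word :=
  pmap (emitted P x) (iota 0 T).

Definition output_times (P : program) (x : word) (T : nat) : seq nat :=
  [seq t.+1 | t <- iota 0 T & isSome (emitted P x t)].

(** * Polynomial time, polynomial delay, and reductions *)

Definition polytime (f : word -> word) : Prop :=
  exists (P : program) (p : {poly nat}), forall x : word,
  exists T : nat,
    [/\ T <= p.[size x]%R, halted P (run P x T) & outputs P x T = [:: f x]].

Definition enum_problem := word -> {fset word}.

(* The bound applies to the time before the first output, between consecutive
   outputs, and between the last output and termination. *)
Definition poly_delay (A : enum_problem) : Prop :=
  exists (P : program) (p : {poly nat}), forall x : word,
  exists T : nat,
    [/\ halted P (run P x T),
        uniq (outputs P x T),
        outputs P x T =i A x
      & path (fun s t => t <= s + p.[size x]%R) 0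
             (rcons (output_times P x T) T)].

Definition pd_reducible (A B : enum_problem) : Prop :=
  exists (f : word -> word) (C : enum_problem),
    [/\ polytime f,
        poly_delay C
      & forall x : word,
          (forall y z : word, y \in B (f x) -> z \in B (f x) -> y != z ->
             (C (x ++ y) `&` C (x ++ z) = fset0)%fset)
          /\ A x = (\bigcup_(y <- B (f x)) C (x ++ y))%fset].

Definition pd_equivalent (A B : enum_problem) : Prop :=
  pd_reducible A B /\ pd_reducible B A.

(** * Encoding of finite families of vectors over F_2

   The family of the m rows of an m x n matrix is encoded by 1^m 0 1^n 0
   followed by the m * n entries in row-major order.  This code is prefix-free,
   so that a concatenation xy with x a code determines both x and y. *)

Definition vec_word n (v : 'rV['F_2]_n) : word :=
  [seq v ord0 j == 1%R | j <- enum 'I_n].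

Definition set_word m (C : {set 'I_m}) : word := [seq i \in C | i <- enum 'I_m].

Definition encode m n (M : 'M['F_2]_(m, n)) : word :=
  nseq m true ++ false :: nseq n true ++ false ::
    flatten [seq vec_word (row i M) | i <- enum 'I_m].

Definition family := {d : nat * nat & 'M['F_2]_(d.1, d.2)}.

Definition Family m n (M : 'M['F_2]_(m, n)) : family :=
  @Tagged _ (m, n) (fun d : nat * nat => 'M['F_2]_(d.1, d.2)) M.

Definition decode (w : word) : option family :=
  let m := index false w in
  let w1 := drop m.+1 w in
  let n := index false w1 in
  let b := drop n.+1 w1 in
  if [&& m < size w, n < size w1 & size b == m * n] then
    Some (Family (\matrix_(i < m, j < n) (nth false b (i * n + j))%:R%R))
  else None.

Lemma F2_eq1K (a : 'F_2) : ((a == 1%R)%:R)%R = a.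
Proof. by case: a => [[|[|]]] // i; apply: val_inj. Qed.

Lemma F2_natr_eq1 (b : bool) : (b%:R == 1 :> 'F_2)%R = b.
Proof. by case: b. Qed.

Lemma size_vec_word n (v : 'rV['F_2]_n) : size (vec_word v) = n.
Proof. by rewrite size_map size_enum_ord. Qed.

Lemma nth_vec_word n (v : 'rV['F_2]_n) (j : 'I_n) :
  nth false (vec_word v) j = (v ord0 j == 1%R).
Proof. by rewrite (nth_map j) ?size_enum_ord // nth_ord_enum. Qed.

Lemma size_rows m n (M : 'M['F_2]_(m, n)) :
  size (flatten [seq vec_word (row i M) | i <- enum 'I_m]) = m * n.
Proof.
rewrite size_flatten /shape -map_comp.
rewrite sumnE big_map (eq_bigr (fun=> n)) => [|i _]; last exact: size_vec_word.
by rewrite big_enum sum_nat_const card_ord.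
Qed.

Lemma nth_flatten_const (T : Type) (x0 : T) n (ss : seq (seq T)) i j :
    all (fun s => size s == n) ss -> j < n ->
  nth x0 (flatten ss) (i * n + j) = nth x0 (nth [::] ss i) j.
Proof.
elim: ss i => [|s ss IH] [|i] //=; rewrite ?nth_nil //.
  by case/andP=> /eqP sz _ lt_jn; rewrite nth_cat sz lt_jn.
case/andP=> /eqP sz ssz lt_jn; rewrite nth_cat sz mulSn -addnA.
by rewrite ltnNge leq_addr /= addKn IH.
Qed.

Lemma nth_rows m n (M : 'M['F_2]_(m, n)) (i : 'I_m) (j : 'I_n) :
  nth false (flatten [seq vec_word (row i M) | i <- enum 'I_m]) (i * n + j)
    = (M i j == 1%R).
Proof.
rewrite nth_flatten_const //.
  by rewrite (nth_map i) ?size_enum_ord // nth_ord_enum nth_vec_word mxE.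
by apply/allP=> s /mapP[k _ ->]; rewrite size_vec_word.
Qed.

Lemma index_nseq_cat n (s : word) : index false (nseq n true ++ false :: s) = n.
Proof. by elim: n => //= n ->. Qed.

Lemma drop_nseq_cat n (s : word) :
  drop n.+1 (nseq n true ++ false :: s) = s.
Proof. by elim: n => //=; rewrite drop0. Qed.

Lemma encodeK m n (M : 'M['F_2]_(m, n)) : decode (encode M) = Some (Family M).
Proof.
rewrite /decode /encode !index_nseq_cat !drop_nseq_cat !index_nseq_cat.
rewrite !drop_nseq_cat size_rows eqxx.
rewrite !size_cat /= !size_nseq !addnS !ltnS !leq_addr /=.
by congr (Some (Family _)); apply/matrixP=> i j; rewrite mxE nth_rows F2_eq1K.
Qed.

Lemma split_index_false (w : word) : index false w < size w ->
  w = nseq (index false w) true ++ false :: drop (index false w).+1 w.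
Proof.
elim: w => [|[] w IH] //=; last by rewrite drop0.
by rewrite ltnS => /IH {1}->.
Qed.

Lemma decodeK w (F : family) : decode w = Some F -> w = encode (tagged F).
Proof.
rewrite /decode; set m := index false w; set w1 := drop m.+1 w.
set n := index false w1; set b := drop n.+1 w1.
case: and3P => // -[lt_m lt_n /eqP sz_b] [<-] {F}.
rewrite [LHS](split_index_false lt_m) -/m -/w1 (split_index_false lt_n) -/n -/b.
rewrite /encode /=; congr (_ ++ _ :: _ ++ _ :: _).
apply: (@eq_from_nth _ false) => [|k]; rewrite ?size_rows // sz_b => lt_k.
have n_gt0 : 0 < n by case: (n) lt_k => //; rewrite muln0.
have lt_i : k %/ n < m by rewrite ltn_divLR.
have lt_j : k %% n < n by rewrite ltn_mod.
rewrite (divn_eq k n).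
by rewrite (nth_rows _ (Ordinal lt_i) (Ordinal lt_j)) mxE F2_natr_eq1.
Qed.

(* Words that encode no family have no solutions. *)
Definition family_problem
    (sol : forall m n, 'M['F_2]_(m, n) -> {fset word}) : enum_problem :=
  fun w => if decode w is Some M then sol _ _ (tagged M) else fset0.

(** * Minimal elements of the closure by exclusive or *)

Definition vec_le n (v u : 'rV['F_2]_n) : bool :=
  [set i | v ord0 i == 1%R] \subset [set i | u ord0 i == 1%R].

Definition minimal_elements n (X : {set 'rV['F_2]_n}) : {set 'rV['F_2]_n} :=
  [set v in X | [forall u in X, vec_le u v ==> (u == v)]].

Definition xor_closed n (X : {set 'rV['F_2]_n}) : bool :=
  [forall u in X, forall v in X, (u + v)%R \in X].

Definition Cl_L0 n (S : {set 'rV['F_2]_n}) : {set 'rV['F_2]_n} :=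
  \bigcap_(X : {set 'rV['F_2]_n} | (S \subset X) && xor_closed X) X.

Definition closure_min_solutions m n (M : 'M['F_2]_(m, n)) : {fset word} :=
  [fset vec_word v | v in
     minimal_elements
       (Cl_L0 [set row i M | i : 'I_m] :\: [set 0%R; const_mx 1%R])]%fset.

Definition EnumClosureMin_L0 : enum_problem :=
  family_problem closure_min_solutions.

(** * Circuits of a binary matroid *)

(* The ground set is the index set of the family, so that equal vectors at
   distinct indices are distinct (parallel) elements. *)
Definition is_circuit m n (M : 'M['F_2]_(m, n)) (C : {set 'I_m}) : bool :=
  minset (fun D : {set 'I_m} => ~~ free [seq row i M | i in D]) C.

Definition circuit_solutions m n (M : 'M['F_2]_(m, n)) : {fset word} :=
  [fset set_word C | C in [set C | is_circuit M C]]%fset.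

Definition EnumBinaryMatroidCircuits : enum_problem :=
  family_problem circuit_solutions.

(* Main.v *)
(** Both problems ask for the vectors of minimal nonzero support in a linear
   code over F_2.  The circuits of a family of vectors are the minimal nonzero
   supports of its space of linear dependencies, a left kernel, and the closure
   of a nonempty family under exclusive or is its span, a row space.  Computing a
   generator matrix of a left kernel therefore turns circuits into minimal
   codewords; conversely, since a row space is the orthogonal of its orthogonal,
   it is the space of dependencies among the columns of a generator matrix of its
   orthogonal.

   The excluded all-ones vector needs care.  It is minimal among the nonzero
   codewords only if the code is {0, 1}, so that in one direction it suffices to
   discard it when translating solutions back; in the other direction a zero
   coordinate is appended to the code, which then does not contain it.

   A generator matrix G of the left kernel of A is obtained by maintaining
   B = G [A | 1], starting with G = 1: as long as column t of G A has an entry 1,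
   say in row i, the product of column t by row i of B is added to B.  This
   clears column t and turns row i into 0, so that no rank bookkeeping is needed,
   and G always has A's number of rows. *)

From HB Require Import structures.
From mathcomp Require Import all_boot all_order all_algebra finmap zify.
Require Import Defs.

Set Implicit Arguments.
Unset Strict Implicit.
Unset Printing Implicit Defensive.

Import GRing.Theory.

(** * A structured language compiled to random access machines *)

Inductive expr :=
| Cst of nat
| Var of nat
| Len
| Plus of expr & expr
| Minus of expr & expr
| Times of expr & expr
| Deref of expr
| Letter of expr.

Inductive cmd :=
| Skip
| Asg of nat & expr
| Sto of expr & expr
| Wr of expr
| Em
| Seq of cmd & cmd
| IfLt of expr & expr & cmd & cmd
| For of nat & cmd.

Record state := State {
  vars : nat -> nat; cells : nat -> nat; sbuf : word; souts : seq word }.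

Definition init_state := State (fun=> 0) (fun=> 0) [::] [::].

Definition set_var s i a := State (upd (vars s) i a) (cells s) (sbuf s) (souts s).

(* The first factor of a product is truncated at the input length, so that the
   product can be computed by a loop of bounded length. *)
Fixpoint eval (x : word) (s : state) (e : expr) : nat :=
  match e with
  | Cst a => a
  | Var i => vars s i
  | Len => size x
  | Plus e1 e2 => eval x s e1 + eval x s e2
  | Minus e1 e2 => eval x s e1 - eval x s e2
  | Times e1 e2 => minn (eval x s e1) (size x) * eval x s e2
  | Deref e1 => cells s (eval x s e1)
  | Letter e1 => input_letter x (eval x s e1)
  end.

(* Every loop runs exactly [size x] times, so that all programs of this language
   run in polynomial time. *)
Fixpoint sem (x : word) (c : cmd) (s : state) : state :=
  match c with
  | Skip => s
  | Asg i e => set_var s i (eval x s e)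
  | Sto e1 e2 =>
      State (vars s) (upd (cells s) (eval x s e1) (eval x s e2)) (sbuf s) (souts s)
  | Wr e => State (vars s) (cells s) (rcons (sbuf s) (eval x s e != 0)) (souts s)
  | Em => State (vars s) (cells s) [::] (rcons (souts s) (sbuf s))
  | Seq c1 c2 => sem x c2 (sem x c1 s)
  | IfLt e1 e2 c1 c2 =>
      if eval x s e1 < eval x s e2 then sem x c1 s else sem x c2 s
  | For i c1 => foldl (fun s k => sem x c1 (set_var s i k)) s (iota 0 (size x))
  end.

(* Variables, temporaries and memory cells live in disjoint residue classes
   modulo 3; temporary 0 holds the input length. *)
Definition rv i := 3 * i.
Definition rt d := 3 * d + 1.
Definition rm a := 3 * a + 2.

(* [compile_expr e d l] is the code of [e] placed at address [l]: it leaves the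
   value of [e] in temporary [d] and only changes temporaries from [d] on. *)
Fixpoint compile_expr (e : expr) (d l : nat) : program :=
  match e with
  | Cst a => [:: Const (rt d) a]
  | Var i => [:: Const (rt d) 0; Add (rt d) (rv i) (rt d)]
  | Len => [:: Const (rt d) 0; Add (rt d) (rt 0) (rt d)]
  | Plus e1 e2 =>
      let p1 := compile_expr e1 d l in
      let p2 := compile_expr e2 d.+1 (l + size p1) in
      p1 ++ p2 ++ [:: Add (rt d) (rt d) (rt d.+1)]
  | Minus e1 e2 =>
      let p1 := compile_expr e1 d l in
      let p2 := compile_expr e2 d.+1 (l + size p1) in
      p1 ++ p2 ++ [:: Sub (rt d) (rt d) (rt d.+1)]
  | Times e1 e2 =>
      let p1 := compile_expr e1 d l in
      let p2 := compile_expr e2 d.+1 (l + size p1) in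
      let q := (l + size p1 + size p2).+2 in
      p1 ++ p2 ++
      [:: Const (rt d.+2) 0; Const (rt d.+3) 0;
          Sub (rt d.+4) (rt d) (rt d.+2); Jz (rt d.+4) (q + 9);
          Sub (rt d.+4) (rt 0) (rt d.+2); Jz (rt d.+4) (q + 9);
          Add (rt d.+3) (rt d.+3) (rt d.+1);
          Const (rt d.+4) 1; Add (rt d.+2) (rt d.+2) (rt d.+4);
          Const (rt d.+4) 0; Jz (rt d.+4) q;
          Const (rt d.+4) 0; Add (rt d) (rt d.+3) (rt d.+4)]
  | Deref e1 =>
      compile_expr e1 d l ++
      [:: Add (rt d.+1) (rt d) (rt d); Add (rt d) (rt d.+1) (rt d);
          Const (rt d.+1) 2; Add (rt d) (rt d) (rt d.+1); Fetch (rt d) (rt d)]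
  | Letter e1 => compile_expr e1 d l ++ [:: Read (rt d) (rt d)]
  end.

(** Jumps are absolute, hence the address [l]. A constant 0 followed by [Jz] is an unconditional
    jump, and adding a zero register makes a copy. A loop counts in temporary [d], of which variable
    [i] only receives a copy, so that a body assigning [i] cannot disturb the count. *)
Fixpoint compile (c : cmd) (d l : nat) : program :=
  match c with
  | Skip => [::]
  | Asg i e =>
      compile_expr e d l ++ [:: Const (rt d.+1) 0; Add (rv i) (rt d) (rt d.+1)]
  | Sto e1 e2 =>
      let p1 := compile_expr e1 d l in
      let p2 := compile_expr e2 d.+1 (l + size p1) in
      p1 ++ p2 ++
      [:: Add (rt d.+2) (rt d) (rt d); Add (rt d) (rt d.+2) (rt d);
          Const (rt d.+2) 2; Add (rt d) (rt d) (rt d.+2);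
          Store (rt d) (rt d.+1)]
  | Wr e => compile_expr e d l ++ [:: Write (rt d)]
  | Em => [:: Emit]
  | Seq c1 c2 =>
      let p1 := compile c1 d l in p1 ++ compile c2 d (l + size p1)
  | IfLt e1 e2 c1 c2 =>
      let p1 := compile_expr e1 d l in
      let p2 := compile_expr e2 d.+1 (l + size p1) in
      let q1 := (l + size p1 + size p2).+2 in
      let p3 := compile c1 d q1 in
      let q2 := (q1 + size p3).+2 in
      let p4 := compile c2 d q2 in
      p1 ++ p2 ++ [:: Sub (rt d) (rt d.+1) (rt d); Jz (rt d) q2] ++ p3 ++
      [:: Const (rt d) 0; Jz (rt d) (q2 + size p4)] ++ p4
  | For i c1 =>
      let p1 := compile c1 d.+1 (l + 5) in
      [:: Const (rt d) 0;
          Sub (rt d.+1) (rt 0) (rt d); Jz (rt d.+1) (l + 9 + size p1);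
          Const (rt d.+1) 0; Add (rv i) (rt d) (rt d.+1)] ++ p1 ++
      [:: Const (rt d.+1) 1; Add (rt d) (rt d) (rt d.+1);
          Const (rt d.+1) 0; Jz (rt d.+1) l.+1]
  end.

Fixpoint expr_cost (e : expr) (N : nat) : nat :=
  match e with
  | Cst _ => 1
  | Var _ | Len => 2
  | Plus e1 e2 | Minus e1 e2 => expr_cost e1 N + expr_cost e2 N + 1
  | Times e1 e2 => expr_cost e1 N + expr_cost e2 N + (N * 9 + 8)
  | Deref e1 => expr_cost e1 N + 5
  | Letter e1 => expr_cost e1 N + 1
  end.

Fixpoint cost (c : cmd) (N : nat) : nat :=
  match c with
  | Skip => 0
  | Asg _ e => expr_cost e N + 2
  | Sto e1 e2 => expr_cost e1 N + expr_cost e2 N + 5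
  | Wr e => expr_cost e N + 1
  | Em => 1
  | Seq c1 c2 => cost c1 N + cost c2 N
  | IfLt e1 e2 c1 c2 =>
      expr_cost e1 N + expr_cost e2 N + (cost c1 N + cost c2 N + 4)
  | For _ c1 => N * (cost c1 N + 8) + 3
  end.

(** * Polynomial bounds on costs *)

Definition poly_bounded (g : nat -> nat) : Prop :=
  exists p : {poly nat}, forall N, g N = (p.[N])%R.

Lemma poly_bounded_cst a : poly_bounded (fun=> a).
Proof. by exists (a%:P)%R => N; rewrite hornerC. Qed.

Lemma poly_bounded_id : poly_bounded id.
Proof. by exists 'X%R => N; rewrite hornerX. Qed.

Lemma poly_boundedD g h :
  poly_bounded g -> poly_bounded h -> poly_bounded (fun N => g N + h N).
Proof. by move=> [p Hp] [q Hq]; exists (p + q)%R => N; rewrite hornerD Hp Hq. Qed.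

Lemma poly_boundedM g h :
  poly_bounded g -> poly_bounded h -> poly_bounded (fun N => g N * h N).
Proof. by move=> [p Hp] [q Hq]; exists (p * q)%R => N; rewrite hornerM Hp Hq. Qed.

Create HintDb pbound.
#[local] Hint Resolve poly_bounded_cst poly_bounded_id : pbound.
#[local] Hint Resolve poly_boundedD poly_boundedM : pbound.

Lemma expr_cost_poly e : poly_bounded (expr_cost e).
Proof. by elim: e => /= *; auto 10 with pbound. Qed.
#[local] Hint Resolve expr_cost_poly : pbound.

Lemma cost_poly c : poly_bounded (cost c).
Proof. by elim: c => /= *; auto 12 with pbound. Qed.

(** * Timed execution of code fragments *)

Fixpoint code_at (P : program) (l : nat) (Q : program) : Prop :=
  if Q is i :: Q' then nth Halt P l = i /\ code_at P l.+1 Q' else True.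

Lemma code_at_cat P l Q1 Q2 :
  code_at P l (Q1 ++ Q2) <-> code_at P l Q1 /\ code_at P (l + size Q1) Q2.
Proof.
elim: Q1 l => [|i Q1 IH] l /=; first by rewrite addn0; tauto.
by rewrite IH addSnnS; tauto.
Qed.

Lemma code_at_suffix Q1 Q2 : code_at (Q1 ++ Q2) (size Q1) Q2.
Proof.
elim: Q2 Q1 => [|i Q2 IH] Q1 //=; split; first by rewrite nth_cat ltnn subnn.
by have := IH (rcons Q1 i); rewrite cat_rcons size_rcons.
Qed.

Section Execution.

Variables (P : program) (x : word).

(** Carrying the emitted words along with the configuration lets runs of code fragments be composed,
    whereas [outputs] refers to a whole run from the start. *)
Definition estep (co : config * seq word) : config * seq word :=
  (step P x co.1,
   if current P co.1 is Emit then rcons co.2 (buf co.1) else co.2).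

Definition wp (n : nat) (c : config) (o : seq word)
    (Q : config -> seq word -> Prop) : Prop :=
  exists2 t, t <= n & Q (iter t estep (c, o)).1 (iter t estep (c, o)).2.

Lemma wp_ret n c o (Q : config -> seq word -> Prop) : Q c o -> wp n c o Q.
Proof. by exists 0. Qed.

Lemma wp_bind n1 n2 c o (Q1 Q2 : config -> seq word -> Prop) :
  wp n1 c o Q1 -> (forall c' o', Q1 c' o' -> wp n2 c' o' Q2) ->
  wp (n1 + n2) c o Q2.
Proof.
move=> [t1 le1 H1] /(_ _ _ H1)[t2 le2].
rewrite -surjective_pairing -iterD addnC => H2.
by exists (t1 + t2); rewrite ?leq_add.
Qed.

Lemma wp_le n1 n2 c o Q : n1 <= n2 -> wp n1 c o Q -> wp n2 c o Q.
Proof. by move=> le12 [t le1 H]; exists t => //; exact: leq_trans le12. Qed.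

Definition exec_instr (i : instr) (l : nat) (r : nat -> nat) (b : word) :=
  match i with
  | Const i a => Config l.+1 (upd r i a) b
  | Add i j k => Config l.+1 (upd r i (r j + r k)) b
  | Sub i j k => Config l.+1 (upd r i (r j - r k)) b
  | Fetch i j => Config l.+1 (upd r i (r (r j))) b
  | Store i j => Config l.+1 (upd r (r i) (r j)) b
  | Read i j => Config l.+1 (upd r i (input_letter x (r j))) b
  | Jz i l' => Config (if r i == 0 then l' else l.+1) r b
  | Write i => Config l.+1 r (rcons b (r i != 0))
  | Emit => Config l.+1 r [::]
  | Halt => Config l r b
  end.

Lemma wp_step n l r b o i (Q : config -> seq word -> Prop) :
  nth Halt P l = i ->
  wp n (exec_instr i l r b) (if i is Emit then rcons o b else o) Q ->
  wp n.+1 (Config l r b) o Q.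
Proof.
move=> Hi [t le H]; exists t.+1 => //; rewrite iterSr.
have -> // : estep (Config l r b, o) =
  (exec_instr i l r b, if i is Emit then rcons o b else o).
by rewrite /estep /= /current /= Hi; case: (i).
Qed.

Definition same_but_temps d (r r' : nat -> nat) : Prop :=
  [/\ forall e, e < d -> r' (rt e) = r (rt e),
      forall i, r' (rv i) = r (rv i)
    & forall a, r' (rm a) = r (rm a)].

(** Temporaries other than 0 are left free. The buffer and the outputs are compared separately, as
    they are not kept in registers. *)
Definition simulates (r : nat -> nat) (s : state) : Prop :=
  [/\ r (rt 0) = size x, forall i, r (rv i) = vars s i
    & forall a, r (rm a) = cells s a].

End Execution.

Lemma rt_eq a b : (rt a == rt b) = (a == b). Proof. rewrite /rt; lia. Qed.
Lemma rv_eq a b : (rv a == rv b) = (a == b). Proof. rewrite /rv; lia. Qed.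
Lemma rm_eq a b : (rm a == rm b) = (a == b). Proof. rewrite /rm; lia. Qed.
Lemma rt_rv a b : (rt a == rv b) = false. Proof. rewrite /rt /rv; lia. Qed.
Lemma rv_rt a b : (rv a == rt b) = false. Proof. rewrite /rt /rv; lia. Qed.
Lemma rt_rm a b : (rt a == rm b) = false. Proof. rewrite /rt /rm; lia. Qed.
Lemma rm_rt a b : (rm a == rt b) = false. Proof. rewrite /rt /rm; lia. Qed.
Lemma rv_rm a b : (rv a == rm b) = false. Proof. rewrite /rv /rm; lia. Qed.
Lemma rm_rv a b : (rm a == rv b) = false. Proof. rewrite /rv /rm; lia. Qed.
Definition reg_eqE := (rt_eq, rv_eq, rm_eq, rt_rv, rv_rt, rt_rm, rm_rt, rv_rm, rm_rv).

Ltac decide_regs :=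
  repeat match goal with
  | |- context [if ?a == ?b :> nat then _ else _] =>
      first [rewrite (_ : (a == b) = true); last by [lia]
           | rewrite (_ : (a == b) = false); last by [lia]]
  end.
Ltac regs := rewrite /= /upd ?reg_eqE; decide_regs.
Ltac wstep := apply: wp_step; [by eassumption | rewrite /=].

Lemma simulates_same d x r r' s :
  0 < d -> same_but_temps d r r' -> simulates x r s -> simulates x r' s.
Proof.
move=> d0 [h1 h2 h3] [s1 s2 s3].
by split=> [|i|a]; rewrite ?h1 ?h2 ?h3.
Qed.

Lemma same_but_temps_trans d r r' r'' :
  same_but_temps d r r' -> same_but_temps d r' r'' -> same_but_temps d r r''.
Proof.
move=> [h1 h2 h3] [k1 k2 k3].
by split=> *; rewrite ?k1 ?k2 ?k3 ?h1 ?h2 ?h3.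
Qed.

Lemma same_but_tempsS d r r' : same_but_temps d.+1 r r' -> same_but_temps d r r'.
Proof. by move=> [h1 h2 h3]; split=> // e lt_e; rewrite h1 // ltnW. Qed.

(** * Correctness of the compiler *)

Definition expr_correct P x e := forall d l r b o s,
    0 < d -> simulates x r s -> code_at P l (compile_expr e d l) ->
  wp P x (expr_cost e (size x)) (Config l r b) o (fun c' o' =>
    exists r', [/\ c' = Config (l + size (compile_expr e d l)) r' b, o' = o,
                   r' (rt d) = eval x s e & same_but_temps d r r']).

(** The second operand is compiled from temporary [d.+1] on, so that its evaluation preserves the
    first value, kept in [d]. *)
Lemma expr_pair_correct P x e1 e2 d l r b o s :
    let p1 := compile_expr e1 d l in
    let p2 := compile_expr e2 d.+1 (l + size p1) in
    expr_correct P x e1 -> expr_correct P x e2 ->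
    0 < d -> simulates x r s -> code_at P l p1 -> code_at P (l + size p1) p2 ->
  wp P x (expr_cost e1 (size x) + expr_cost e2 (size x)) (Config l r b) o
    (fun c' o' => exists r',
      [/\ c' = Config (l + size p1 + size p2) r' b, o' = o,
          r' (rt d) = eval x s e1, r' (rt d.+1) = eval x s e2
        & same_but_temps d r r']).
Proof.
move=> p1 p2 H1 H2 d_gt0 sim C1 C2.
apply: wp_bind; first exact: (H1 _ _ _ _ _ _ d_gt0 sim C1).
move=> _ _ [r1 [-> -> v1 same1]].
have sim1 := simulates_same d_gt0 same1 sim.
have [t le_t] := H2 d.+1 _ _ b o _ isT sim1 C2.
move=> [r2 [E1 E2 v2 same2]]; exists t => //; exists r2; split=> //.
  by case: same2 => -> //.
exact: same_but_temps_trans same1 (same_but_tempsS same2).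
Qed.

Lemma compile_expr_correct P x e : expr_correct P x e.
Proof.
elim: e => [a|i||e1 IH1 e2 IH2|e1 IH1 e2 IH2|e1 IH1 e2 IH2|e1 IH1|e1 IH1]
  d l r b o s d_gt0 sim /=.
- move=> [h1 _]; wstep; apply: wp_ret;
  eexists; split; [rewrite addn1; reflexivity | by [] | | ].
    by regs.
  by split=> *; regs.
- case: (sim) => s1 s2 s3.
  move=> [h1 [h2 _]]; do 2 wstep; apply: wp_ret;
  eexists; split; [rewrite addn2; reflexivity | by [] | | ].
    by regs; rewrite addn0.
  by split=> *; regs.
- case: (sim) => s1 s2 s3.
  move=> [h1 [h2 _]]; do 2 wstep; apply: wp_ret;
  eexists; split; [rewrite addn2; reflexivity | by [] | | ].
    by regs; rewrite addn0.
  by split=> *; regs.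
- move=> /code_at_cat[C1 /code_at_cat[C2 [h1 _]]].
  apply: wp_bind; first exact: (expr_pair_correct _ _ IH1 IH2 d_gt0 sim C1 C2).
  move=> _ _ [r1 [-> -> v1 v2 same1]]; wstep; apply: wp_ret.
  eexists; split; [rewrite !size_cat /= addn1 !addnS addnA; reflexivity | by [] | | ].
    by regs; rewrite v1 v2.
  by apply: same_but_temps_trans same1 _; split=> *; regs.
- move=> /code_at_cat[C1 /code_at_cat[C2 [h1 _]]].
  apply: wp_bind; first exact: (expr_pair_correct _ _ IH1 IH2 d_gt0 sim C1 C2).
  move=> _ _ [r1 [-> -> v1 v2 same1]]; wstep; apply: wp_ret.
  eexists; split; [rewrite !size_cat /= addn1 !addnS addnA; reflexivity | by [] | | ].
    by regs; rewrite v1 v2.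
  by apply: same_but_temps_trans same1 _; split=> *; regs.
- move=> /code_at_cat[C1 /code_at_cat[C2 /= C3]].
  apply: wp_bind; first exact: (expr_pair_correct _ _ IH1 IH2 d_gt0 sim C1 C2).
  move=> _ _ [r1 [-> -> v1 v2 same1]].
  rewrite !size_cat /=; move: C3.
  set p1 := compile_expr e1 d l; set p2 := compile_expr e2 _ _.
  set q := _ + size p2; set A := eval x s e1 in v1 *; set B := eval x s e2 in v2 *.
  have -> : l + (size p1 + (size p2 + 13)) = q + 13 by rewrite /q !addnA.
  have [s1 s2 s3] := simulates_same d_gt0 same1 sim.
  move=> [h0 [h1 [h2 [h3 [h4 [h5 [h6 [h7 [h8 [h9 [h10 [h11 [h12 _]]]]]]]]]]]]].
  (* Invariant of the multiplication loop after [k] rounds: temporary [d.+2] counts the rounds and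
     [d.+3] holds [k * B]. One exit test stops at [A] and the other at the input length, hence the
     minimum. *)
  have loop k r2 : k <= minn A (size x) -> same_but_temps d.+2 r1 r2 ->
      r2 (rt d.+2) = k -> r2 (rt d.+3) = k * B ->
    wp P x ((minn A (size x) - k) * 9 + 6) (Config q.+2 r2 b) o (fun c' o' =>
     exists r', [/\ c' = Config (q + 13) r' b, o' = o,
                 r' (rt d) = minn A (size x) * B & same_but_temps d r1 r']).
    move E : (minn A (size x) - k) => j.
    elim: j k r2 E => [|j IHj] k r2 E lek same2 vk vkB.
      have {E} Ek : k = minn A (size x) by lia.
      case: (same2) => t1 t2 t3.
      have fin r3 : same_but_temps d.+2 r1 r3 -> r3 (rt d.+3) = minn A (size x) * B ->
        wp P x 2 (Config (q + 11) r3 b) o (fun c' o' =>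
          exists r', [/\ c' = Config (q + 13) r' b, o' = o,
            r' (rt d) = minn A (size x) * B & same_but_temps d r1 r']).
        move=> [u1 u2 u3] v3.
        rewrite !addnS addn0; do 2 wstep; apply: wp_ret;
        eexists; split; [reflexivity | by [] | | ].
          by regs; rewrite addn0.
        by split=> *; regs; rewrite ?u1 ?u2 ?u3 //; lia.
      have same3 a : same_but_temps d.+2 r1 (upd r2 (rt d.+4) a).
        by split=> *; regs; rewrite ?t1 ?t2 ?t3 //; lia.
      have [leA|leA] : A <= size x \/ size x < A by lia.
        do 2 wstep.
        have -> : upd r2 (rt d.+4) (r2 (rt d) - r2 (rt d.+2)) (rt d.+4) = 0.
          by regs; rewrite vk t1 ?v1 //; lia.
        rewrite /= (_ : q.+2 + 9 = q + 11); last by lia.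
        apply: (@wp_le _ _ 2) => //; apply: fin; first exact: same3.
        by regs; rewrite vkB Ek.
      do 2 wstep.
      have -> : (upd r2 (rt d.+4) (r2 (rt d) - r2 (rt d.+2)) (rt d.+4) == 0) = false.
        by regs; rewrite vk t1 ?v1 //; lia.
      do 2 wstep; set r3 := upd r2 _ _.
      have -> : upd r3 (rt d.+4) (r3 (rt 0) - r3 (rt d.+2)) (rt d.+4) = 0.
        by rewrite /r3; regs; rewrite vk t1 ?s1 //; lia.
      rewrite /= (_ : q.+2 + 9 = q + 11); last by lia.
      apply: fin; last by rewrite /r3; regs; rewrite vkB Ek.
      by rewrite /r3; split=> *; regs; rewrite ?t1 ?t2 ?t3 //; lia.
    case: (same2) => t1 t2 t3.
    rewrite mulSn -addnA.
    do 2 wstep.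
    have -> : (upd r2 (rt d.+4) (r2 (rt d) - r2 (rt d.+2)) (rt d.+4) == 0) = false.
      by regs; rewrite vk t1 ?v1 //; lia.
    do 2 wstep; set r3 := upd r2 _ _.
    have -> : (upd r3 (rt d.+4) (r3 (rt 0) - r3 (rt d.+2)) (rt d.+4) == 0) = false.
      by rewrite /r3; regs; rewrite vk t1 ?s1 //; lia.
    do 5 wstep.
    rewrite [upd _ (rt d.+4) 0 (rt d.+4)]/upd eqxx /=.
    apply: (IHj k.+1); try lia.
    - by rewrite /r3; split=> *; regs; rewrite ?t1 ?t2 ?t3 //; lia.
    - by rewrite /r3; regs; rewrite vk addn1.
    - by rewrite /r3; regs; rewrite vkB t1 ?v2 ?mulSn ?[_ + B]addnC //; lia.
  apply: (@wp_le _ _ (size x * 9 + 6).+2); [by lia | do 2 wstep].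
  have : wp P x ((minn A (size x) - 0) * 9 + 6)
     (Config q.+2 (upd (upd r1 (rt d.+2) 0) (rt d.+3) 0) b) o (fun c' o' =>
     exists r', [/\ c' = Config (q + 13) r' b, o' = o,
                 r' (rt d) = minn A (size x) * B & same_but_temps d r1 r']).
    apply: loop => //; try by regs.
    by split=> *; regs.
  move=> [t le_t [r' [E1 E2 vd same']]]; exists t; first lia.
  exists r'; split=> //; exact: same_but_temps_trans same1 same'.
- move=> /code_at_cat[C1 [h0 [h1 [h2 [h3 [h4 _]]]]]].
  apply: wp_bind; first exact: (IH1 _ _ _ _ _ _ d_gt0 sim C1).
  move=> _ _ [r1 [-> -> v1 same1]]; do 5 wstep; apply: wp_ret.
  have [s1 s2 s3] := simulates_same d_gt0 same1 sim.
  eexists; split; [rewrite size_cat /= !addnS addn0; reflexivity | by [] | | ].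
    regs; rewrite v1.
    (* Two additions triple the address and 2 is added, which gives the register of a memory
       cell. *)
    rewrite (_ : _ + 2 = rm (eval x s e1)); last by rewrite /rm; lia.
    by rewrite ?reg_eqE s3.
  by apply: same_but_temps_trans same1 _; split=> *; regs.
- move=> /code_at_cat[C1 [h0 _]].
  apply: wp_bind; first exact: (IH1 _ _ _ _ _ _ d_gt0 sim C1).
  move=> _ _ [r1 [-> -> v1 same1]]; wstep; apply: wp_ret.
  eexists; split; [rewrite size_cat /= !addnS addn0; reflexivity | by [] | | ].
    by regs; rewrite v1.
  by apply: same_but_temps_trans same1 _; split=> *; regs.
Qed.

(** Temporaries below [d] include the input length and the counters of enclosing loops, and so have
    to be preserved. *)
Definition cmd_correct P x c := forall d l r s,
    0 < d -> simulates x r s -> code_at P l (compile c d l) ->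
  wp P x (cost c (size x)) (Config l r (sbuf s)) (souts s) (fun c' o' =>
    exists r', [/\ c' = Config (l + size (compile c d l)) r' (sbuf (sem x c s)),
                   o' = souts (sem x c s), simulates x r' (sem x c s)
                 & forall e, e < d -> r' (rt e) = r (rt e)]).

Lemma compile_correct P x c : cmd_correct P x c.
Proof.
have ok := @compile_expr_correct P x.
elim: c => [|i e|e1 e2|e||c1 IH1 c2 IH2|e1 e2 c1 IH1 c2 IH2|i c1 IH1]
  d l r s d_gt0 sim /=.
- by move=> _; apply: wp_ret; exists r; split; rewrite ?addn0.
- move=> /code_at_cat[C1 [h0 [h1 _]]].
  apply: wp_bind; first exact: (ok _ _ _ _ _ _ _ d_gt0 sim C1).
  move=> _ _ [r1 [-> -> v1 same1]]; do 2 wstep; apply: wp_ret.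
  have [s1 s2 s3] := simulates_same d_gt0 same1 sim.
  case: same1 => t1 t2 t3.
  eexists; split; [rewrite size_cat addn2 !addnS; reflexivity | by [] | |].
    split=> [|j|a]; regs; rewrite // v1 addn0.
    by case: eqP => _; rewrite ?s2.
  by move=> e' lt_e'; regs; rewrite t1.
- move=> /code_at_cat[C1 /code_at_cat[C2 [h0 [h1 [h2 [h3 [h4 _]]]]]]].
  apply: wp_bind; first exact: (expr_pair_correct _ _ (ok _) (ok _) d_gt0 sim C1 C2).
  move=> _ _ [r1 [-> -> v1 v2 same1]]; do 5 wstep; apply: wp_ret.
  have [s1 s2 s3] := simulates_same d_gt0 same1 sim.
  case: same1 => t1 t2 t3.
  set r2 := upd _ (rt d) _.
  have v1' : r2 (rt d) = rm (eval x s e1).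
    by rewrite /r2; regs; rewrite v1 /rm; lia.
  have v2' : r2 (rt d.+1) = eval x s e2 by rewrite /r2; regs.
  exists (upd r2 (r2 (rt d)) (r2 (rt d.+1))); rewrite v1' v2'; split=> //.
  - by rewrite !size_cat /= !addnS addn0 !addnA.
  - by rewrite /r2; split=> [|j|a]; regs; rewrite ?s3.
  - by move=> e' lt_e'; rewrite /r2; regs; rewrite t1.
- move=> /code_at_cat[C1 [h0 _]].
  apply: wp_bind; first exact: (ok _ _ _ _ _ _ _ d_gt0 sim C1).
  move=> _ _ [r1 [-> -> v1 same1]]; wstep; apply: wp_ret.
  exists r1; split=> //.
  - by rewrite v1 size_cat addn1 addnS.
  - by case: (simulates_same d_gt0 same1 sim).
  - by case: same1.
- by move=> [h0 _]; wstep; apply: wp_ret; exists r; rewrite addn1; split.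
- move=> /code_at_cat[C1 C2].
  apply: wp_bind; first exact: (IH1 _ _ _ _ d_gt0 sim C1).
  move=> _ _ [r1 [-> -> sim1 t1]].
  have [t le_t [r' [E1 E2 sim2 t2]]] := IH2 _ _ _ _ d_gt0 sim1 C2.
  exists t => //; exists r'; split=> //; first by rewrite size_cat addnA.
  by move=> e' lt_e'; rewrite t2 ?t1.
- set p1 := compile_expr e1 d l; set p2 := compile_expr e2 _ _.
  set q1 := (_ + size p2).+2; set p3 := compile c1 d q1.
  set q2 := (q1 + _).+2; set p4 := compile c2 d q2.
  move=> /code_at_cat[C1 /code_at_cat[C2 [h0 [h1 /code_at_cat[C3 [h2 [h3 C4]]]]]]].
  apply: wp_bind; first exact: (expr_pair_correct _ _ (ok _) (ok _) d_gt0 sim C1 C2).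
  move=> _ _ [r1 [-> -> v1 v2 same1]]; rewrite addnC; do 2 wstep.
  set r2 := upd r1 _ _.
  have same2 : same_but_temps d r r2.
    by apply: same_but_temps_trans same1 _; split=> *; rewrite /r2; regs.
  have sim2 := simulates_same d_gt0 same2 sim.
  have -> : r2 (rt d) = eval x s e2 - eval x s e1 by rewrite /r2; regs; rewrite v1 v2.
  have -> : l + size (p1 ++ p2 ++ [:: Sub (rt d) (rt d.+1) (rt d),
       Jz (rt d) q2 & p3 ++ [:: Const (rt d) 0, Jz (rt d) (q2 + size p4) & p4]])
       = q2 + size p4.
    by rewrite !size_cat /= size_cat /= /q2 /q1; lia.
  rewrite subn_eq0 ltnNge; case: leqP => /= _.
    have [t le_t [r' [E1 E2 sim3 t3]]] := IH2 _ _ _ _ d_gt0 sim2 C4.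
    exists t; first lia; exists r'; split=> //.
    by move=> e' lt_e'; rewrite t3 //; case: same2 => ->.
  apply: (@wp_le _ _ (cost c1 (size x) + 2)); first by lia.
  apply: wp_bind; first exact: (IH1 _ _ _ _ d_gt0 sim2 C3).
  move=> _ _ [r3 [-> -> sim3 t3]]; do 2 wstep; apply: wp_ret.
  rewrite [upd _ _ _ (rt d)]/upd eqxx /=.
  eexists; split; [reflexivity | by [] | |].
    by case: sim3 => u1 u2 u3; split=> *; regs; rewrite ?u1 ?u2 ?u3.
  by move=> e' lt_e'; regs; rewrite t3 //; case: same2 => ->.
- set p1 := compile c1 d.+1 _ => -[h0 [h1 [h2 [h3 [h4 /code_at_cat[C1]]]]]].
  rewrite -/p1 => -[h5 [h6 [h7 [h8 _]]]].
  rewrite size_cat /= (_ : l + (_ + 4).+4.+1 = l + 9 + size p1); last by lia.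
  have {C1} C1 : code_at P (l + 5) p1 by rewrite !addnS addn0.
  have loop j k r1 s1 : k + j = size x -> simulates x r1 s1 ->
      r1 (rt d) = k -> (forall e, e < d -> r1 (rt e) = r (rt e)) ->
    wp P x (j * (cost c1 (size x) + 8) + 2) (Config l.+1 r1 (sbuf s1)) (souts s1)
     (fun c' o' =>
       let s' := foldl (fun s k => sem x c1 (set_var s i k)) s1 (iota k j) in
       exists r', [/\ c' = Config (l + 9 + size p1) r' (sbuf s'), o' = souts s',
                  simulates x r' s' & forall e, e < d -> r' (rt e) = r (rt e)]).
    elim: j k r1 s1 => [|j IHj] k r1 s1 Ek [u1 u2 u3] vk t1.
      do 2 wstep; rewrite [upd _ _ _ (rt d.+1)]/upd eqxx u1 vk.
      rewrite (_ : (size x - k == 0) = true) /=; last by lia.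
      apply: wp_ret; eexists; split; [reflexivity | by [] | |].
        by split=> *; regs.
      by move=> e' lt_e'; regs; rewrite t1.
    apply: (@wp_le _ _ (cost c1 (size x) + (j * (cost c1 (size x) + 8) + 2).+4).+4).
      by lia.
    do 2 wstep.
    rewrite [upd _ _ _ (rt d.+1)]/upd eqxx u1 vk.
    rewrite (_ : (size x - k == 0) = false) /=; last by lia.
    do 2 wstep; set r2 := upd _ (rv i) _.
    have -> : sbuf s1 = sbuf (set_var s1 i k) by [].
    have -> : souts s1 = souts (set_var s1 i k) by [].
    have sim2 : simulates x r2 (set_var s1 i k).
      split=> [|a|a]; rewrite /r2 /=; regs; rewrite // vk addn0.
      by case: eqP => _; rewrite ?u2.
    rewrite (_ : l.+1.+4 = l + 5); last by lia.
    apply: wp_bind; first exact: (IH1 d.+1 _ _ _ isT sim2 C1).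
    move=> _ _ [r3 [-> -> sim3 t3]].
    rewrite -/p1 (_ : l + 5 + _ = l.+1.+4 + size p1); last by lia.
    do 4 wstep; rewrite [upd _ _ _ (rt d.+1)]/upd eqxx /=.
    have {}t3 e' : e' < d.+1 -> r3 (rt e') = r1 (rt e').
      by move=> lt_e'; rewrite t3 // /r2; regs.
    apply: (IHj k.+1); try lia.
    - by case: sim3 => w1 w2 w3; split=> *; regs; rewrite ?w1 ?w2 ?w3.
    - by regs; rewrite t3 // vk addn1.
    - by move=> e' lt_e'; regs; rewrite t3 ?t1 //; lia.
  rewrite addnS; wstep.
  have := loop (size x) 0 (upd r (rt d) 0) s (add0n _); apply=> //.
  - by case: sim => u1 u2 u3; split=> *; regs.
  - by regs.
  - by move=> e' lt_e'; regs.
Qed.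

(** * From commands to polynomial time and polynomial delay *)

(** No instruction gives the input length, so letters are counted up to the first position that
    reads 2: subtracting the letter from 2 gives zero there and a positive number on a bit. *)
Definition input_length_code : program :=
  [:: Const (rt 0) 0; Read (rt 1) (rt 0); Const (rt 2) 2;
      Sub (rt 1) (rt 2) (rt 1); Jz (rt 1) 9; Const (rt 1) 1;
      Add (rt 0) (rt 0) (rt 1); Const (rt 1) 0; Jz (rt 1) 1].

Lemma input_length_code_correct P x :
    code_at P 0 input_length_code ->
  wp P x (size x * 8 + 5) init_config [::] (fun c' o' =>
    exists r', [/\ c' = Config 9 r' [::], o' = [::] & simulates x r' init_state]).
Proof.
move=> [h0 [h1 [h2 [h3 [h4 [h5 [h6 [h7 [h8 _]]]]]]]]].
have loop j k r : k + j = size x -> r (rt 0) = k ->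
    (forall i, r (rv i) = 0) -> (forall i, r (rm i) = 0) ->
  wp P x (j * 8 + 4) (Config 1 r [::]) [::] (fun c' o' =>
    exists r', [/\ c' = Config 9 r' [::], o' = [::] & simulates x r' init_state]).
  elim: j k r => [|j IHj] k r Ek vk Hv Hm.
    do 4 wstep; set r2 := upd _ _ _.
    have -> : r2 (rt 1) = 0.
      by rewrite /r2; regs; rewrite /input_letter vk; case: ltnP => //; lia.
    apply: wp_ret; exists r2; split=> //.
    by split=> *; rewrite /r2; regs => //; lia.
  rewrite mulSn -addnA; do 4 wstep; set r2 := upd _ _ _.
  have -> : (r2 (rt 1) == 0) = false.
    rewrite /r2; regs; rewrite /input_letter vk.
    by case: ltnP; [case: nth | lia].
  do 4 wstep; rewrite [upd _ _ _ (rt 1)]/upd eqxx /=.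
  apply: (IHj k.+1) => [||i|i]; rewrite /r2; regs; rewrite ?Hv ?Hm //; lia.
rewrite addnS; wstep; apply: (loop (size x) 0) => // *; by regs.
Qed.

Lemma iter_estep P x t :
  iter t (estep P x) (init_config, [::]) = (run P x t, outputs P x t).
Proof.
elim: t => [|t IH] //; rewrite iterS IH /estep /= /outputs -addn1 iotaD pmap_cat /=.
rewrite add0n; congr pair.
by rewrite /emitted; case: current; rewrite ?cats0 // cats1.
Qed.

(** The prelude computing the input length occupies addresses 0 to 8 and leaves its result in
    temporary 0, so the command is compiled from address 9 and temporary 1. In the end control
    leaves the program text, which halts. *)
Theorem cmd_run (c : cmd) : exists (P : program) (p : {poly nat}),
  forall x, exists T, [/\ T <= (p.[size x])%R, halted P (run P x T)
                        & outputs P x T = souts (sem x c init_state)].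
Proof.
pose Q := compile c 1 9; exists (input_length_code ++ Q).
have [p Hp] : poly_bounded (fun N => N * 8 + 5 + cost c N).
  by have := cost_poly c; auto 10 with pbound.
exists p => x; rewrite -Hp; set P := _ ++ Q.
have C1 : code_at P 0 input_length_code by [].
have C2 : code_at P 9 Q by exact: code_at_suffix.
have [T le_T] : wp P x (size x * 8 + 5 + cost c (size x)) init_config [::]
    (fun c' o' => pc c' = 9 + size Q /\ o' = souts (sem x c init_state)).
  apply: wp_bind; first exact: input_length_code_correct.
  move=> _ _ [r [-> -> sim]].
  have [t le_t [r' [E1 E2 _ _]]] := @compile_correct P x c 1 9 r _ isT sim C2.
  by exists t => //; rewrite E1 E2.
rewrite iter_estep /= => -[pcT outT]; exists T; split=> //.
by rewrite /halted /current pcT nth_default // size_cat.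
Qed.

Lemma polytime_cmd (c : cmd) (f : word -> word) :
  (forall x, souts (sem x c init_state) = [:: f x]) -> polytime f.
Proof.
move=> Hf; have [P [p HP]] := cmd_run c; exists P, p => x.
by have [T [H1 H2 H3]] := HP x; exists T; rewrite H3 Hf.
Qed.

Lemma path_le_bound b (s : seq nat) a :
  all (fun t => t <= b) s -> path (fun u t => t <= u + b) a s.
Proof.
by elim: s a => //= t s IH a /andP[le_t /IH ->]; rewrite (leq_trans le_t) ?leq_addl.
Qed.

(** The whole run takes polynomial time, and this total bounds each delay. *)
Lemma poly_delay_cmd (c : cmd) (C : enum_problem) :
    (forall x, uniq (souts (sem x c init_state))) ->
    (forall x, souts (sem x c init_state) =i C x) ->
  poly_delay C.
Proof.
move=> Hu HC; have [P [p HP]] := cmd_run c; exists P, p => x.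
have [T [H1 H2 H3]] := HP x; exists T; rewrite H3; split=> //.
apply: path_le_bound; rewrite all_rcons H1 /=.
apply/allP => t /mapP[u]; rewrite mem_filter mem_iota => /andP[_ lt_u] ->.
exact: leq_trans H1.
Qed.

(** * Frame properties and loop invariants *)

Fixpoint assigned (c : cmd) : seq nat :=
  match c with
  | Asg i _ => [:: i]
  | Seq c1 c2 | IfLt _ _ c1 c2 => assigned c1 ++ assigned c2
  | For i c1 => i :: assigned c1
  | _ => [::]
  end.

Fixpoint lacks (p : pred cmd) (c : cmd) : bool :=
  ~~ p c && match c with
  | Seq c1 c2 | IfLt _ _ c1 c2 => lacks p c1 && lacks p c2
  | For _ c1 => lacks p c1
  | _ => true
  end.

Definition is_sto c := if c is Sto _ _ then true else false.
Definition is_em c := if c is Em then true else false.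
(** [Em] counts as well, since it empties the buffer. *)
Definition is_wr c := match c with Em | Wr _ => true | _ => false end.

Lemma foldl_inv (S T : Type) (I : S -> Prop) (f : S -> T -> S) s r :
  (forall s k, I s -> I (f s k)) -> I s -> I (foldl f s r).
Proof. by move=> Hf; elim: r s => //= k r IH s /(Hf s k)/IH. Qed.

Lemma vars_frame x c s u :
  u \notin assigned c -> vars (sem x c s) u = vars s u.
Proof.
elim: c s => //= [i e|c1 IH1 c2 IH2|e1 e2 c1 IH1 c2 IH2|i c1 IH1] s.
- by rewrite inE /upd => /negbTE->.
- by rewrite mem_cat negb_or => /andP[/IH1 H1 /IH2 H2]; rewrite H2 H1.
- by rewrite mem_cat negb_or => /andP[/IH1 H1 /IH2 H2]; case: ifP.
- rewrite inE negb_or => /andP[/negbTE ui /IH1 H1].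
  elim/last_ind: (iota _ _) => //= r k IH; rewrite foldl_rcons H1 /= /upd ui.
  exact: IH.
Qed.

Lemma cells_frame x c s : lacks is_sto c -> cells (sem x c s) = cells s.
Proof.
elim: c s => //= [c1 IH1 c2 IH2|e1 e2 c1 IH1 c2 IH2|i c1 IH1] s.
- by move=> /andP[/IH1 H1 /IH2 H2]; rewrite H2 H1.
- by move=> /andP[/IH1 H1 /IH2 H2]; case: ifP.
- by move=> /IH1 H1; apply: (@foldl_inv _ _ (fun s' => cells s' = cells s)) => // s' k <-;
    rewrite H1.
Qed.

Lemma buf_frame x c s : lacks is_wr c -> sbuf (sem x c s) = sbuf s.
Proof.
elim: c s => //= [c1 IH1 c2 IH2|e1 e2 c1 IH1 c2 IH2|i c1 IH1] s.
- by move=> /andP[/IH1 H1 /IH2 H2]; rewrite H2 H1.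
- by move=> /andP[/IH1 H1 /IH2 H2]; case: ifP.
- by move=> /IH1 H1; apply: (@foldl_inv _ _ (fun s' => sbuf s' = sbuf s)) => // s' k <-;
    rewrite H1.
Qed.

Lemma outs_frame x c s : lacks is_em c -> souts (sem x c s) = souts s.
Proof.
elim: c s => //= [c1 IH1 c2 IH2|e1 e2 c1 IH1 c2 IH2|i c1 IH1] s.
- by move=> /andP[/IH1 H1 /IH2 H2]; rewrite H2 H1.
- by move=> /andP[/IH1 H1 /IH2 H2]; case: ifP.
- by move=> /IH1 H1; apply: (@foldl_inv _ _ (fun s' => souts s' = souts s)) => // s' k <-;
    rewrite H1.
Qed.

Lemma for_ind x i c s (I : nat -> state -> Prop) :
    I 0 s ->
    (forall k s', k < size x -> I k s' -> I k.+1 (sem x c (set_var s' i k))) ->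
  I (size x) (sem x (For i c) s).
Proof.
move=> I0 IS /=; elim: {-2}(size x) (leqnn (size x)) => [|k IH] le_k //.
by rewrite -addn1 iotaD foldl_cat addn1 /=; apply: IS => //; exact/IH/ltnW.
Qed.

Definition ForLt i v c := For i (IfLt (Var i) (Var v) c Skip).

(** [For] always makes [size x] rounds. Those from the value of [v] on do nothing, so the invariant
    at round [k] is [I] at the minimum of [k] and that value. As the loop does not assign [v], the
    guard is stable. *)
Lemma for_lt_ind x i v c s0 (I : nat -> (nat -> nat) -> word -> Prop) :
    v \notin i :: assigned c -> vars s0 v <= size x ->
    I 0 (cells s0) (sbuf s0) ->
    (forall k s, k < vars s0 v -> vars s i = k ->
       (forall u, u \notin i :: assigned c -> vars s u = vars s0 u) ->
       I k (cells s) (sbuf s) ->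
       I k.+1 (cells (sem x c s)) (sbuf (sem x c s))) ->
  I (vars s0 v) (cells (sem x (ForLt i v c) s0)) (sbuf (sem x (ForLt i v c) s0)).
Proof.
move=> nv le_v I0 IS.
pose J k s := I (minn k (vars s0 v)) (cells s) (sbuf s) /\
  forall u, u \notin i :: assigned c -> vars s u = vars s0 u.
suff [] : J (size x) (sem x (ForLt i v c) s0) by rewrite (minn_idPr le_v).
apply: for_ind; first by split; rewrite ?min0n.
move=> k s lt_k [Is Hs].
have set_u u : u \notin i :: assigned c -> vars (set_var s i k) u = vars s0 u.
  by move=> nu; rewrite -Hs //= /upd; move: nu; rewrite inE negb_or => /andP[/negbTE->].
have E : sem x (IfLt (Var i) (Var v) c Skip) (set_var s i k) =
   if k < vars s0 v then sem x c (set_var s i k) else set_var s i k.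
  by rewrite -(set_u v nv) /= {1}/upd eqxx.
rewrite E; case: ltnP => [lt_kv|le_vk]; last first.
  by split=> //; move: Is; rewrite (minn_idPr le_vk) (minn_idPr (leqW le_vk)).
move: Is; rewrite (minn_idPl (ltnW lt_kv)) => Is.
split; last first.
  move=> u nu; rewrite vars_frame ?set_u //.
  by move: nu; rewrite inE negb_or => /andP[].
rewrite (minn_idPl lt_kv); apply: IS => //.
by rewrite /= /upd eqxx.
Qed.

(** * Programs computing with matrices *)

(** [vM] and [vN] hold the dimensions of the input, [vR] and [vC] those of the matrix [A] to be
    reduced (the input or its transpose), and [vW] the width of [[A | 1]]. [vT] is the pivot column,
    [vI] the candidate pivot row, and [vJ] and [vK] are auxiliary indices. *)
Definition vM := 0.
Definition vN := 1.
Definition vR := 2.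
Definition vC := 3.
Definition vW := 4.
Definition vT := 5.
Definition vI := 6.
Definition vJ := 7.
Definition vK := 8.

(** The stride [L] will be the input length: programs have it as [Len], and it bounds the width of
    the augmented matrix, so that rows do not overlap. *)
Definition mat (L : nat) (h : nat -> nat) (j k : nat) : nat := h (j * L + k).

Lemma mat_upd L h j k a j' k' : k < L -> k' < L ->
  mat L (upd h (j * L + k) a) j' k' =
    if (j' == j) && (k' == k) then a else mat L h j' k'.
Proof.
move=> lt_k lt_k'; rewrite /mat /upd.
have -> // : (j' * L + k' == j * L + k) = (j' == j) && (k' == k).
have [->|neq] /= := eqVneq j' j; first by rewrite eqn_add2l.
apply/eqP => E; case/eqP: neq.
have := congr1 (fun a => a %/ L) E.
by rewrite /= !divnMDl ?(divn_small lt_k) ?(divn_small lt_k') ?addn0 //; lia.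
Qed.

Definition addr (e1 e2 : expr) := Plus (Times e1 Len) e2.
Definition cell (e1 e2 : expr) := Deref (addr e1 e2).
(** With truncated subtraction this is the absolute difference, which is exclusive or on 0 and 1. *)
Definition xor_expr (e1 e2 : expr) := Plus (Minus e1 e2) (Minus e2 e1).
Definition xorn a b := (a - b) + (b - a).

Definition xor_row :=
  ForLt vK vW (Sto (addr (Var vJ) (Var vK))
    (xor_expr (cell (Var vJ) (Var vK)) (cell (Var vR) (Var vK)))).

(** The pivot row is saved in row [vR], just below the matrix: [xor_rows] also adds it to itself,
    which clears it, while later rows still need it. *)
Definition copy_row :=
  ForLt vK vW (Sto (addr (Var vR) (Var vK)) (cell (Var vI) (Var vK))).

Definition xor_rows :=
  ForLt vJ vR (IfLt (Cst 0) (cell (Var vJ) (Var vT)) xor_row Skip).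

Definition pivot :=
  IfLt (Cst 0) (cell (Var vI) (Var vT)) (Seq copy_row xor_rows) Skip.

Definition eliminate := ForLt vT vC (ForLt vI vR pivot).

Section ProgramSpec.

Variable x : word.
Local Notation L := (size x).

Lemma copy_row_spec s : vars s vW <= L -> vars s vR <= L -> vars s vI < vars s vR ->
  forall j k, k < L -> mat L (cells (sem x copy_row s)) j k =
    if (j == vars s vR) && (k < vars s vW) then mat L (cells s) (vars s vI) k
    else mat L (cells s) j k.
Proof.
move=> leW leR ltI.
apply: (@for_lt_ind x vK vW _ s (fun kk h _ => forall j k, k < L -> mat L h j k =
   if (j == vars s vR) && (k < kk) then mat L (cells s) (vars s vI) k
    else mat L (cells s) j k)) => //.
  by move=> j k _; rewrite andbF.
move=> kk s' lt_kk Ek Hs IH j k lt_k.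
have ER : vars s' vR = vars s vR by exact: Hs.
have EI : vars s' vI = vars s vI by exact: Hs.
have -> : cells (sem x (Sto (addr (Var vR) (Var vK)) (cell (Var vI) (Var vK))) s') =
  upd (cells s') (vars s vR * L + kk) (mat L (cells s') (vars s vI) kk).
  by rewrite /= Ek ER EI !(minn_idPl _) //; lia.
rewrite mat_upd ?IH //; try lia.
have [->|nj] := eqVneq j; last by [].
rewrite ltnS /=; have [->|nk] := eqVneq k kk; rewrite ?leqnn.
  by rewrite (_ : _ == _ = false) //; lia.
by rewrite [in RHS]leq_eqVlt (negbTE nk).
Qed.

Lemma xor_row_spec s : vars s vW <= L -> vars s vR <= L -> vars s vJ < vars s vR ->
  forall j k, k < L -> mat L (cells (sem x xor_row s)) j k =
    if (j == vars s vJ) && (k < vars s vW)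
    then xorn (mat L (cells s) j k) (mat L (cells s) (vars s vR) k)
    else mat L (cells s) j k.
Proof.
move=> leW leR ltJ.
apply: (@for_lt_ind x vK vW _ s (fun kk h _ => forall j k, k < L -> mat L h j k =
    if (j == vars s vJ) && (k < kk)
    then xorn (mat L (cells s) j k) (mat L (cells s) (vars s vR) k)
    else mat L (cells s) j k)) => //.
  by move=> j k _; rewrite andbF.
move=> kk s' lt_kk Ek Hs IH j k lt_k.
have ER : vars s' vR = vars s vR by exact: Hs.
have EJ : vars s' vJ = vars s vJ by exact: Hs.
have -> : cells (sem x (Sto (addr (Var vJ) (Var vK))
    (xor_expr (cell (Var vJ) (Var vK)) (cell (Var vR) (Var vK)))) s') =
  upd (cells s') (vars s vJ * L + kk)
   (xorn (mat L (cells s') (vars s vJ) kk) (mat L (cells s') (vars s vR) kk)).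
  by rewrite /= Ek ER EJ !(minn_idPl _) //; lia.
rewrite mat_upd //; last by lia.
rewrite !IH ?eqxx ?ltnn ?andbF //=; try lia.
have [->|nj] := eqVneq j; last by [].
rewrite ltnS /=; have [->|nk] := eqVneq k kk; rewrite ?leqnn //.
by rewrite [in RHS]leq_eqVlt (negbTE nk).
Qed.

Lemma xor_rows_spec s : vars s vW <= L -> vars s vR <= L -> vars s vT < L ->
  forall j k, k < L -> mat L (cells (sem x xor_rows s)) j k =
    if [&& j < vars s vR, k < vars s vW & 0 < mat L (cells s) j (vars s vT)]
    then xorn (mat L (cells s) j k) (mat L (cells s) (vars s vR) k)
    else mat L (cells s) j k.
Proof.
move=> leW leR ltT.
apply: (@for_lt_ind x vJ vR _ s (fun jj h _ => forall j k, k < L -> mat L h j k =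
    if [&& j < jj, k < vars s vW & 0 < mat L (cells s) j (vars s vT)]
    then xorn (mat L (cells s) j k) (mat L (cells s) (vars s vR) k)
    else mat L (cells s) j k)) => //.
move=> jj s' lt_jj Ej Hs IH j k lt_k.
have ER : vars s' vR = vars s vR by exact: Hs.
have ET : vars s' vT = vars s vT by exact: Hs.
have EW : vars s' vW = vars s vW by exact: Hs.
have -> : sem x (IfLt (Cst 0) (cell (Var vJ) (Var vT)) xor_row Skip) s' =
   if 0 < mat L (cells s) jj (vars s vT) then sem x xor_row s' else s'.
  rewrite -[if _ then _ else sem x Skip s']/(if _ then _ else s').
  rewrite [sem _ _ _]/= -/(sem x xor_row s').
  by rewrite (minn_idPl _) Ej ?ET -?/(mat _ _ _ _) ?IH ?ltnn //; lia.
case: ifP => pos; last first.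
  rewrite IH // ltnS; have [->|nj] := eqVneq j jj; first by rewrite pos ltnn !andbF.
  by rewrite [in RHS]leq_eqVlt (negbTE nj).
rewrite xor_row_spec ?ER ?EW ?Ej // !IH //.
have -> : (vars s vR < jj) = false by lia.
rewrite ltnS /=; have [->|nj] := eqVneq j jj; first by rewrite ltnn leqnn pos andbT.
by rewrite [in RHS]leq_eqVlt (negbTE nj).
Qed.

(** Thanks to the saved copy, all entries on the right are those before the step. Row [vR] is left
    out, as it may have been overwritten. *)
Lemma pivot_spec s :
    vars s vW <= L -> vars s vR <= L -> vars s vT < L -> vars s vI < vars s vR ->
  forall j k, j < vars s vR -> k < vars s vW -> mat L (cells (sem x pivot s)) j k =
    if (0 < mat L (cells s) (vars s vI) (vars s vT)) &&
       (0 < mat L (cells s) j (vars s vT))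
    then xorn (mat L (cells s) j k) (mat L (cells s) (vars s vI) k)
    else mat L (cells s) j k.
Proof.
move=> leW leR ltT ltI j k lt_j lt_k.
have -> : sem x pivot s =
   if 0 < mat L (cells s) (vars s vI) (vars s vT)
   then sem x xor_rows (sem x copy_row s) else s.
  by rewrite [sem x pivot s]/= (minn_idPl _) //; lia.
case: ifP => pos //=.
set s1 := sem x copy_row s.
have E u : u \notin [:: vK] -> vars s1 u = vars s u by move=> nu; exact: vars_frame.
have lt_kL : k < L by lia.
rewrite xor_rows_spec ?E // lt_j lt_k /= !copy_row_spec //.
have -> : (j == vars s vR) = false by lia.
by rewrite eqxx lt_k.
Qed.

End ProgramSpec.

(** * Gaussian elimination over the two-element field *)

Lemma F2_addE (a b : 'F_2) : (a + b == 1)%R = (a == 1)%R (+) (b == 1)%R.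
Proof. by case: a => [[|[|]]] // ?; case: b => [[|[|]]] // ?. Qed.

Lemma F2_mulE (a b : 'F_2) : (a * b == 1)%R = (a == 1)%R && (b == 1)%R.
Proof. by case: a => [[|[|]]] // ?; case: b => [[|[|]]] // ?. Qed.

Lemma F2_neq0 (a : 'F_2) : (a != 0)%R = (a == 1)%R.
Proof. by case: a => [[|[|]]]. Qed.

Lemma xorn_bool (a b : bool) : xorn a b = a (+) b.
Proof. by case: a; case: b. Qed.

Section Elimination.

Variables (R C : nat) (A : 'M['F_2]_(R, C)).

Local Notation aug G := (G *m row_mx A 1%:M)%R.

Definition represents (L : nat) (h : nat -> nat) (G : 'M['F_2]_R) : Prop :=
  forall (j : 'I_R) (k : 'I_(C + R)), mat L h j k = (aug G j k == 1)%R.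

Lemma aug_l (G : 'M['F_2]_R) j (k : 'I_C) : aug G j (lshift R k) = (G *m A)%R j k.
Proof. by rewrite mul_mx_row row_mxEl. Qed.

Lemma aug_r (G : 'M['F_2]_R) j (k : 'I_R) : aug G j (rshift C k) = G j k.
Proof. by rewrite mul_mx_row row_mxEr mulmx1. Qed.

(* [G] generates the left kernel of [A] once [G *m A = 0]; the last clause says
   that the columns before [t], and the first [i] entries of column [t], of
   [G *m A] have been cleared. *)
Definition elim_inv (L t i : nat) (h : nat -> nat) : Prop :=
  exists G : 'M['F_2]_R,
    [/\ represents L h G,
        forall c : 'rV['F_2]_R, (c *m A = 0)%R -> exists d, c = (d *m G)%R
      & forall (j : 'I_R) (k : 'I_C), (k < t) || (k == t :> nat) && (j < i) ->
          (G *m A)%R j k = 0%R].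

(** If row [i] of [G *m A] has a 0 in column [t], nothing changes. Otherwise [G] becomes
    [G + a *m row i G] with [a] this column: column [t] turns into [a + a = 0], and earlier columns
    stay zero because row [i] vanishes there. *)
Lemma elim_inv_step L h h' (t : 'I_C) (i : 'I_R) :
    (forall j k, j < R -> k < C + R -> mat L h' j k =
       if (0 < mat L h i t) && (0 < mat L h j t)
       then xorn (mat L h j k) (mat L h i k) else mat L h j k) ->
  elim_inv L t i h -> elim_inv L t i.+1 h'.
Proof.
move=> Hh' [G [rep ker cleared]].
have Et (j : 'I_R) : mat L h j t = ((G *m A)%R j t == 1)%R :> nat.
  by rewrite (rep j (lshift R t)) aug_l.
have [Ep|] := boolP ((G *m A)%R i t == 1)%R; last first.
  move=> nEp; exists G; split=> //.
    by move=> j k; rewrite Hh' // Et (negbTE nEp) /= rep.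
  move=> j k /orP[lt_k|/andP[/eqP Ek]]; first by apply: cleared; rewrite lt_k.
  rewrite ltnS leq_eqVlt => /orP[/eqP Ej|lt_j]; last first.
    by apply: cleared; rewrite Ek eqxx lt_j orbT.
  rewrite (ord_inj Ej) (ord_inj Ek).
  by apply/eqP; move: nEp; rewrite -F2_neq0 negbK.
pose G' := (G + col t (G *m A) *m row i G)%R.
have augE j k : aug G' j k = (aug G j k + (G *m A) j t * aug G i k)%R.
  by rewrite mulmxDl -mulmxA -row_mul !mxE big_ord1 !mxE.
have GA' j k : (G' *m A)%R j k = ((G *m A) j k + (G *m A) j t * (G *m A) i k)%R.
  by rewrite -[LHS]aug_l augE !aug_l.
exists G'; split.
- move=> j k; rewrite Hh' // Et Ep Et augE F2_addE F2_mulE !(rep _ k).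
  by case: ifP => [/= |]; case: (_ == 1)%R => //=; rewrite ?xorn_bool ?addbF.
(* The witness [d] is unchanged: [d *m G *m A = c *m A = 0], so [d] annihilates column [t] of
   [G *m A] and the added term contributes nothing. *)
- move=> c cA0; have [d Ec] := ker c cA0; exists d.
  by rewrite mulmxDr -Ec colE !mulmxA -Ec cA0 !mul0mx addr0.
- move=> j k; rewrite GA' => /orP[lt_k|/andP[/eqP/ord_inj-> _]].
    by rewrite (cleared j k) ?lt_k // (cleared i k) ?lt_k // mulr0 addr0.
  by rewrite (eqP Ep) mulr1; apply/eqP; rewrite -(negbK (_ == 0)%R) F2_neq0 F2_addE addbb.
Qed.

Lemma elim_inv_next_row L t h : elim_inv L t R h -> elim_inv L t.+1 0 h.
Proof.
move=> [G [rep ker cleared]]; exists G; split=> // j k H; apply: cleared.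
by move: H; rewrite ltn0 andbF orbF ltnS leq_eqVlt orbC => /orP[->|->] //;
   rewrite ltn_ord orbT.
Qed.

Lemma eliminate_spec x s :
    vars s vR = R -> vars s vC = C -> vars s vW = C + R -> C + R <= size x ->
  elim_inv (size x) 0 0 (cells s) -> elim_inv (size x) C 0 (cells (sem x eliminate s)).
Proof.
move=> ER EC EW leL I0; rewrite -EC.
apply: (@for_lt_ind x vT vC _ s (fun t h _ => elim_inv (size x) t 0 h)) => //.
  by rewrite EC; lia.
move=> t s1 lt_t Et Hs1 It; apply: elim_inv_next_row.
have ER1 : vars s1 vR = R by rewrite Hs1.
have EW1 : vars s1 vW = C + R by rewrite Hs1.
rewrite -{1}ER1.
apply: (@for_lt_ind x vI vR _ s1 (fun i h _ => elim_inv (size x) t i h)) => //.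
  by rewrite ER1; lia.
move=> i s2 lt_i Ei Hs2 Ii; rewrite EC in lt_t; rewrite ER1 in lt_i.
have ER2 : vars s2 vR = R by rewrite Hs2.
have EW2 : vars s2 vW = C + R by rewrite Hs2.
have ET2 : vars s2 vT = t by rewrite Hs2.
apply: (@elim_inv_step _ (cells s2) _ (Ordinal lt_t) (Ordinal lt_i)) => //= j k lt_j lt_k.
rewrite -ER2 in lt_j; rewrite -EW2 in lt_k.
by rewrite pivot_spec ?ET2 ?Ei ?ER2 ?EW2 //; lia.
Qed.

End Elimination.

(** * Reading the input matrix and writing the result *)

(** Position of the first entry, after the two unary dimensions and their separators. *)
Definition offset := Plus (Plus (Var vM) (Var vN)) (Cst 2).

(* With [tr] the transpose of the input matrix is loaded, and the transpose of
   the computed matrix is written. *)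
Definition position (tr : bool) :=
  if tr then Plus offset (Plus (Times (Var vK) (Var vN)) (Var vJ))
  else Plus offset (Plus (Times (Var vJ) (Var vN)) (Var vK)).

(** Of the identity block only the ones are stored, memory being initially zero. *)
Definition load_matrix (tr : bool) :=
  ForLt vJ vR (Seq (Sto (addr (Var vJ) (Plus (Var vC) (Var vJ))) (Cst 1))
    (ForLt vK vC (Sto (addr (Var vJ) (Var vK)) (Letter (position tr))))).

Definition pos_of (tr : bool) m n j k :=
  m + n + 2 + (if tr then k * n + j else j * n + k).

Definition out_cell (tr : bool) :=
  if tr then cell (Var vK) (Plus (Var vC) (Var vJ))
  else cell (Var vJ) (Plus (Var vC) (Var vK)).

Definition write_row tr :=
  Seq (ForLt vK vR (Wr (out_cell tr))) (Wr (Cst 0)).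
(** The word written encodes a matrix with [R] rows and [R + 1] columns whose last column is zero:
    hence the separate one in the header and the zero ending each row. *)
Definition write_matrix tr :=
  Seq (ForLt vK vR (Wr (Cst 1)))
  (Seq (Wr (Cst 0))
  (Seq (ForLt vK vR (Wr (Cst 1)))
  (Seq (Wr (Cst 1))
  (Seq (Wr (Cst 0)) (ForLt vJ vR (write_row tr)))))).

Section IOSpec.

Variable x : word.
Local Notation L := (size x).

Lemma load_matrix_spec tr s :
    vars s vC + vars s vR <= L -> (forall a, cells s a = 0) ->
  forall j k, j < vars s vR -> k < L -> mat L (cells (sem x (load_matrix tr) s)) j k =
    if k < vars s vC then input_letter x (pos_of tr (vars s vM) (vars s vN) j k)
    else k == vars s vC + j.
Proof.
move=> leL mem0.
suff : forall j k, k < L -> mat L (cells (sem x (load_matrix tr) s)) j k =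
    if j < vars s vR then
      if k < vars s vC then input_letter x (pos_of tr (vars s vM) (vars s vN) j k)
      else k == vars s vC + j
    else 0.
  by move=> H j k lt_j lt_k; rewrite H // lt_j.
apply: (@for_lt_ind x vJ vR _ s (fun jj h _ => forall j k, k < L -> mat L h j k =
   if j < jj then
      if k < vars s vC then input_letter x (pos_of tr (vars s vM) (vars s vN) j k)
      else k == vars s vC + j
    else 0)) => //; try lia.
  by move=> j k _; exact: mem0.
move=> jj s1 lt_jj Ej Hs1 IH j k lt_k.
set s2 := sem x (Sto (addr (Var vJ) (Plus (Var vC) (Var vJ))) (Cst 1)) s1.
have EC : vars s2 vC = vars s vC by exact: Hs1.
have M2 j' k' : k' < L -> mat L (cells s2) j' k' =
    if (j' == jj) && (k' == vars s vC + jj) then 1 else mat L (cells s1) j' k'.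
  move=> lt_k'; have -> : cells s2 = upd (cells s1) (jj * L + (vars s vC + jj)) 1.
    by rewrite /= Ej Hs1 // (minn_idPl _) //; lia.
  by rewrite mat_upd //; lia.
suff H : forall j k, k < L -> mat L (cells
    (sem x (ForLt vK vC (Sto (addr (Var vJ) (Var vK)) (Letter (position tr)))) s2)) j k =
    if (j == jj) && (k < vars s2 vC)
    then input_letter x (pos_of tr (vars s vM) (vars s vN) j k) else mat L (cells s2) j k.
  rewrite [sem _ (Seq _ _) _]/= H // M2 // IH // EC ltnS.
  have [->|nj] := eqVneq j jj; last by rewrite [in RHS]leq_eqVlt (negbTE nj).
  by rewrite leqnn ltnn /=; case: ifP => // _; case: eqP.
apply: (@for_lt_ind x vK vC _ s2 (fun kk h _ => forall j k, k < L -> mat L h j k =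
    if (j == jj) && (k < kk)
    then input_letter x (pos_of tr (vars s vM) (vars s vN) j k)
    else mat L (cells s2) j k)) => //; try by rewrite EC; lia.
  by move=> *; rewrite andbF.
rewrite EC => kk s3 lt_kk Ek Hs3 IH3 j' k' lt_k'.
have EJ3 : vars s3 vJ = jj by rewrite Hs3.
have EM3 : vars s3 vM = vars s vM by rewrite Hs3 // -Hs1.
have EN3 : vars s3 vN = vars s vN by rewrite Hs3 // -Hs1.
have -> : cells (sem x (Sto (addr (Var vJ) (Var vK)) (Letter (position tr))) s3) =
  upd (cells s3) (jj * L + kk)
    (input_letter x (pos_of tr (vars s vM) (vars s vN) jj kk)).
  by rewrite /pos_of; case: (tr) => /=; rewrite Ek EJ3 EM3 EN3 !(minn_idPl _) //; lia.
rewrite mat_upd ?IH3 //; last by lia.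
have [->|nj] := eqVneq j' jj; last by [].
rewrite ltnS /=; have [->|nk] := eqVneq k' kk; rewrite ?leqnn //.
by rewrite [in RHS]leq_eqVlt (negbTE nk).
Qed.

Lemma write_ones_spec s : vars s vR <= L ->
  sbuf (sem x (ForLt vK vR (Wr (Cst 1))) s) = sbuf s ++ nseq (vars s vR) true.
Proof.
move=> leR.
apply: (@for_lt_ind x vK vR _ s (fun k _ b => b = sbuf s ++ nseq k true)) => //.
  by rewrite cats0.
move=> k s1 _ _ _ /= ->; rewrite -cats1 -catA; congr cat.
by elim: k => //= k ->.
Qed.

Definition out_bit (tr : bool) h C j k :=
  (if tr then mat L h k (C + j) else mat L h j (C + k)) != 0.

Lemma iotaS_map (T : Type) (F : nat -> T) k :
  [seq F i | i <- iota 0 k.+1] = rcons [seq F i | i <- iota 0 k] (F k).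
Proof. by rewrite -addn1 iotaD map_cat cats1. Qed.

Lemma write_row_spec tr s : vars s vR <= L -> vars s vJ <= L ->
  sbuf (sem x (write_row tr) s) = sbuf s ++
    rcons [seq out_bit tr (cells s) (vars s vC) (vars s vJ) k | k <- iota 0 (vars s vR)]
      false.
Proof.
move=> leR leJ; rewrite -rcons_cat /=; congr (rcons _ _).
have := @for_lt_ind x vK vR (Wr (out_cell tr)) s (fun k h b => h = cells s /\
  b = sbuf s ++ [seq out_bit tr (cells s) (vars s vC) (vars s vJ) k | k <- iota 0 k]).
case=> //; first by split=> //; rewrite cats0.
move=> k s1 lt_k Ek Hs1 [E1 E2]; split=> //.
rewrite iotaS_map -rcons_cat -E2 [LHS]/=.
congr (rcons _ _); rewrite /out_bit /out_cell.
have EC : vars s1 vC = vars s vC by exact: Hs1.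
have EJ : vars s1 vJ = vars s vJ by exact: Hs1.
by case: (tr); rewrite /= Ek EC EJ E1 (minn_idPl _) //; lia.
Qed.

Lemma write_matrix_spec tr s : vars s vR <= L ->
  let R := vars s vR in
  sbuf (sem x (write_matrix tr) s) = sbuf s ++ nseq R true ++ false :: nseq R.+1 true ++
    false :: flatten [seq rcons [seq out_bit tr (cells s) (vars s vC) j k | k <- iota 0 R]
      false | j <- iota 0 R].
Proof.
move=> leR R.
rewrite [sem _ _ _]/=.
set c1 := ForLt vK vR (Wr (Cst 1)).
rewrite -[foldl _ _ _]/(sem x (ForLt vJ vR (write_row tr)) _).
set s5 := State _ _ _ _.
have V5 u : u \notin [:: vK] -> vars s5 u = vars s u.
  by move=> nu; rewrite (vars_frame x (c := c1)) //= (vars_frame x (c := c1)).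
have M5 : cells s5 = cells s.
  by rewrite /= (cells_frame x (c := c1)) //= (cells_frame x (c := c1)).
have B5 : sbuf s5 = sbuf s ++ nseq R true ++ false :: nseq R.+1 true ++ [:: false].
  have E1 : sbuf (sem x c1 s) = sbuf s ++ nseq R true by exact: write_ones_spec.
  set s1 := State (vars (sem x c1 s)) (cells (sem x c1 s))
              (rcons (sbuf (sem x c1 s)) false) (souts (sem x c1 s)).
  have R1 : vars s1 vR = R by rewrite /= (vars_frame x (c := c1)).
  have E2 : sbuf (sem x c1 s1) = sbuf s1 ++ nseq R true.
    by rewrite -R1; apply: write_ones_spec; rewrite R1.
  have -> : sbuf s5 = rcons (rcons (sbuf (sem x c1 s1)) true) false by [].
  rewrite E2 /= E1.
  rewrite -!cats1 -!catA; congr cat; congr cat => /=; congr cons.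
  by elim: (R) => //= r ->.
suff -> : sbuf (sem x (ForLt vJ vR (write_row tr)) s5) =
    sbuf s5 ++ flatten [seq rcons
      [seq out_bit tr (cells s) (vars s vC) j k | k <- iota 0 R] false
      | j <- iota 0 (vars s5 vR)].
  by rewrite V5 // B5 -!catA /= -!catA /=.
have := @for_lt_ind x vJ vR (write_row tr) s5 (fun j h b => h = cells s5 /\
  b = sbuf s5 ++ flatten [seq rcons
    [seq out_bit tr (cells s) (vars s vC) j k | k <- iota 0 R] false | j <- iota 0 j]).
rewrite V5 //; case=> //; first by split=> //; rewrite cats0.
move=> j s6 lt_j Ej Hs6 [E1 E2].
have V6 u : u \notin [:: vJ; vK] -> vars s6 u = vars s u.
  by move=> nu; rewrite Hs6 // V5 //; move: nu; rewrite !inE negb_or => /andP[].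
split; first by rewrite cells_frame // E1.
rewrite write_row_spec ?Ej ?V6 //; last by lia.
by rewrite E1 M5 E2 iotaS_map flatten_rcons catA.
Qed.

End IOSpec.

(** * Parsing the dimensions, and the kernel program *)

(** [dst] counts the ones from [off] on. It falls behind [vK] at the first zero or at the end of the
    input, and then stays fixed. The end is tested explicitly because letters past it read as 2. *)
Definition parse_letter (dst : nat) (off : expr) :=
  IfLt (Var dst) (Var vK) Skip
    (IfLt (Plus off (Var vK)) Len
      (IfLt (Cst 0) (Letter (Plus off (Var vK))) (Asg dst (Plus (Var vK) (Cst 1))) Skip)
      Skip).

Definition parse (dst : nat) (off : expr) :=
  Seq (Asg dst (Cst 0)) (For vK (parse_letter dst off)).

Lemma parse_spec x dst off p s : dst != vK ->
    (forall s', (forall u, u \notin [:: dst; vK] -> vars s' u = vars s u) ->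
       eval x s' off = p) ->
  vars (sem x (parse dst off) s) dst = index false (drop p x).
Proof.
move=> dstK Eoff; set y := drop p x; set I := index false y.
have leI : I <= size x.
  by rewrite (leq_trans (index_size _ _)) // size_drop leq_subr.
pose J k s' := vars s' dst = minn k I /\
  forall u, u \notin [:: dst; vK] -> vars s' u = vars s u.
suff [] : J (size x) (sem x (parse dst off) s) by rewrite (minn_idPr leI).
apply: (@for_ind x vK (parse_letter dst off) (set_var s dst 0) J).
  split; first by rewrite /= /upd eqxx min0n.
  by move=> u; rewrite inE negb_or /= /upd => /andP[/negbTE->].
move=> k s1 lt_k [E1 E2].
set s2 := set_var s1 vK k.
have Ek : vars s2 vK = k by rewrite /= /upd eqxx.
have Ed : vars s2 dst = minn k I by rewrite /= /upd (negbTE dstK).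
have Eu u : u \notin [:: dst; vK] -> vars s2 u = vars s u.
  by move=> nu; rewrite -E2 //= /upd; move: nu; rewrite !inE => /norP[_ /negbTE->].
have Ep : eval x s2 off = p by exact: Eoff.
clearbody s2; rewrite /= Ek Ed Ep.
case: ltnP => [lt1|le1]; first by split; rewrite ?Ed //; lia.
have leI' : k <= I by lia.
have [lt_p|le_p] := ltnP (p + k) (size x); last first.
  have leI2 : I <= size x - p by rewrite -size_drop index_size.
  by split=> //; rewrite Ed; lia.
have letterE : input_letter x (p + k) = nth false y k.
  by rewrite /input_letter lt_p nth_drop.
rewrite letterE.
move: leI'; rewrite leq_eqVlt => /orP[/eqP kI|lt_kI].
  rewrite kI nth_index; first by split=> //=; rewrite Ed; lia.
  by rewrite -index_mem (_ : index _ _ = k) // size_drop ltn_subRL.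
have -> : nth false y k = true by have := before_find false lt_kI; case: nth.
split; first by rewrite /= /upd eqxx; lia.
by move=> u nu; rewrite -Eu //= /upd; move: nu; rewrite inE negb_or => /andP[/negbTE->].
Qed.

Definition header (tr : bool) :=
  Seq (parse vM (Cst 0))
  (Seq (parse vN (Plus (Var vM) (Cst 1)))
  (Seq (Asg vR (Var (if tr then vN else vM)))
  (Seq (Asg vC (Var (if tr then vM else vN)))
       (Asg vW (Plus (Var vC) (Var vR)))))).

(** These are the dimensions that [decode] reads, here given for every word, since the programs also
    run on words that are not codes. *)
Definition rows_of (x : word) := index false x.
Definition cols_of (x : word) := index false (drop (rows_of x).+1 x).

Lemma header_spec tr x (s := sem x (header tr) init_state)
    (m := rows_of x) (n := cols_of x) :
  [/\ [/\ vars s vM = m, vars s vN = n, vars s vR = (if tr then n else m),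
          vars s vC = (if tr then m else n) & vars s vW = m + n],
      cells s = (fun=> 0), sbuf s = [::] & souts s = [::]].
Proof.
split; [|by rewrite /s cells_frame //; case: (tr)|by rewrite /s buf_frame //; case: (tr)
        |by rewrite /s outs_frame //; case: (tr)].
rewrite {}/s /header.
set c1 := parse vM _; set c2 := parse vN _; set c3 := Seq (Asg vR _) _.
have -> : sem x (Seq c1 (Seq c2 c3)) init_state =
  sem x c3 (sem x c2 (sem x c1 init_state)) by [].
have E1 : vars (sem x c1 init_state) vM = m.
  by rewrite (@parse_spec _ _ _ 0) ?drop0.
set s1 := sem x c1 init_state in E1 *.
have E2 : vars (sem x c2 s1) vN = n.
  apply: parse_spec => // s' Hs' /=.
  by rewrite Hs' // E1 addn1.
have E3 : vars (sem x c2 s1) vM = m by rewrite vars_frame.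
set s2 := sem x c2 s1 in E2 E3 *; clearbody s2.
by rewrite {}/c3 /=; case: tr; rewrite /upd /= E2 E3 // addnC.
Qed.

Lemma rows_of_le x : rows_of x <= size x.
Proof. exact: index_size. Qed.

Lemma cols_of_le x : cols_of x <= size x.
Proof. by rewrite (leq_trans (index_size _ _)) // size_drop leq_subr. Qed.

Definition total := Plus offset (Times (Var vM) (Var vN)).

(** The two comparisons test whether the input has the length of a code. If not, the output is the
    empty word, which encodes no family. *)
Definition kernel_prog (tr : bool) :=
  Seq (header tr)
    (IfLt Len total Em (IfLt total Len Em
       (Seq (load_matrix tr) (Seq eliminate (Seq (write_matrix tr) Em))))).

Definition code_size (x : word) := rows_of x + cols_of x + 2 + rows_of x * cols_of x.

(** The equation on the length already forces both separating zeros to be present, so a program can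
    recognize codes by it alone. *)
Lemma decode_NoneE x : decode x = None -> size x != code_size x.
Proof.
rewrite /decode -/(rows_of x) -/(cols_of x) /code_size; case: and3P => // H _.
apply/eqP => E; case: H; rewrite !size_drop; split; lia.
Qed.

Lemma total_spec tr x :
  eval x (sem x (header tr) init_state) total = code_size x.
Proof.
have [[EM EN _ _ _] _ _ _] := header_spec tr x.
set s := sem x (header tr) init_state in EM EN *; clearbody s.
by rewrite /= EM EN (minn_idPl (rows_of_le x)).
Qed.

Lemma kernel_progE tr x (s := sem x (header tr) init_state) :
  sem x (kernel_prog tr) init_state =
    if size x == code_size x then
      sem x (Seq (load_matrix tr) (Seq eliminate (Seq (write_matrix tr) Em))) s
    else sem x Em s.
Proof.
rewrite -[LHS]/(if eval x s Len < eval x s total then sem x Em s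
  else if eval x s total < eval x s Len then sem x Em s else _).
rewrite total_spec /= -/s.
by case: ltngtP.
Qed.

Lemma kernel_prog_None tr x :
  decode x = None -> souts (sem x (kernel_prog tr) init_state) = [:: [::]].
Proof.
move=> /decode_NoneE/negbTE sz; rewrite kernel_progE sz /=.
by have [_ _ -> ->] := header_spec tr x.
Qed.

Lemma row_word_pad R (G : 'M['F_2]_R) (F : nat -> nat -> bool) (j : 'I_R) :
    (forall j k : 'I_R, F j k = (G j k == 1)%R) ->
  vec_word (row j (row_mx G (0 : 'M_(R, 1)))) =
    rcons [seq F j k | k <- iota 0 R] false.
Proof.
move=> HF; apply: (@eq_from_nth _ false).
  by rewrite size_vec_word size_rcons size_map size_iota addn1.
rewrite size_vec_word => k lt_k.
rewrite (nth_vec_word _ (Ordinal lt_k)) nth_rcons size_map size_iota.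
rewrite 2!mxE; case: splitP => [k' /= Ek|k' /= Ek].
  by rewrite Ek ltn_ord (nth_map 0) ?size_iota // nth_iota // add0n -HF.
by rewrite mxE Ek ltnNge leq_addr /= if_same.
Qed.

Lemma encode_pad R (G : 'M['F_2]_R) (F : nat -> nat -> bool) :
    (forall j k : 'I_R, F j k = (G j k == 1)%R) ->
  encode (row_mx G (0 : 'M_(R, 1))) = nseq R true ++ false :: nseq R.+1 true ++
    false :: flatten [seq rcons [seq F j k | k <- iota 0 R] false | j <- iota 0 R].
Proof.
move=> HF; rewrite /encode.
rewrite (_ : nseq (R + 1) true = nseq R.+1 true); last by rewrite addn1.
congr (_ ++ _ :: _ ++ _ :: flatten _).
transitivity [seq rcons [seq F j k | k <- iota 0 R] false
  | j <- [seq val i | i <- enum 'I_R]]; last by rewrite val_enum_ord.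
by rewrite -map_comp; apply: eq_map => j /=; exact: row_word_pad.
Qed.

Definition tr_if (b : bool) n (G : 'M['F_2]_n) := (if b then G^T else G)%R.

(** [A] is given through the letters at its positions, so that one proof serves the input matrix and
    its transpose. *)
Lemma kernel_prog_spec tr x R C (A : 'M['F_2]_(R, C)) :
    size x = code_size x ->
    R = (if tr then cols_of x else rows_of x) ->
    C = (if tr then rows_of x else cols_of x) ->
    (forall (j : 'I_R) (k : 'I_C),
       input_letter x (pos_of tr (rows_of x) (cols_of x) j k) = (A j k == 1)%R) ->
  exists G : 'M['F_2]_R,
    [/\ (G *m A = 0)%R,
        forall c : 'rV['F_2]_R, (c *m A = 0)%R -> exists d, c = (d *m G)%R
      & souts (sem x (kernel_prog tr) init_state) =
          [:: encode (row_mx (tr_if tr G) (0 : 'M_(R, 1)))%R]].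
Proof.
move=> sz ER EC letters; rewrite kernel_progE sz eqxx.
have [[VM VN VR VC VW] M0 B0 O0] := header_spec tr x.
set s0 := sem x (header tr) init_state in VM VN VR VC VW M0 B0 O0 *.
have leL : C + R <= size x by rewrite sz /code_size ER EC; case: (tr); lia.
rewrite -ER in VR; rewrite -EC in VC.
have {}VW : vars s0 vW = C + R by rewrite VW ER EC; case: (tr) => //; rewrite addnC.
clearbody s0.
set s1 := sem x (load_matrix tr) s0; set s2 := sem x eliminate s1.
have -> : sem x (Seq (load_matrix tr) (Seq eliminate (Seq (write_matrix tr) Em))) s0 =
  sem x Em (sem x (write_matrix tr) s2) by [].
(* The loaded memory is [[A | 1]], which represents [G = 1]. *)
have I1 : elim_inv A (size x) 0 0 (cells s1).
  exists 1%:M%R; split=> [j k|c cA|j k]; first last.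
  - by rewrite ltn0 andbF.
  - by exists c; rewrite mulmx1.
  rewrite /s1 load_matrix_spec ?VR ?VC ?M0 //; last first.
    by rewrite (leq_trans _ leL).
  rewrite VM VN mul1mx mxE; case: splitP => k' /= Ek.
    by rewrite Ek letters.
  by rewrite Ek eqn_add2l mxE F2_natr_eq1 eq_sym.
have V1 u : u \notin [:: vJ; vK] -> vars s1 u = vars s0 u.
  by move=> nu; apply: vars_frame; case: (tr).
have [G [rep ker GA]] : elim_inv A (size x) C 0 (cells s2).
  by apply: eliminate_spec; rewrite ?V1.
have V2 u : u \notin [:: vT; vI; vJ; vK] -> vars s2 u = vars s0 u.
  move=> nu; rewrite /s2 vars_frame ?V1 //.
    by move: nu; rewrite !inE !negb_or => /and4P[_ _ -> ->].
  by move: nu; rewrite /= !inE !negb_or => /and4P[-> -> -> ->].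
exists G; split=> //; last rewrite [souts _]/=.
  by apply/matrixP => j k; rewrite GA ?mxE // ltn_ord.
have -> : souts (sem x (write_matrix tr) s2) = [::].
  rewrite outs_frame; last by case: (tr).
  by rewrite /s2 outs_frame // /s1 outs_frame //; case: (tr).
rewrite write_matrix_spec ?V2 ?VR //; last by lia.
have -> : sbuf s2 = [::].
  by rewrite /s2 buf_frame // /s1 buf_frame //; case: (tr).
rewrite /= (encode_pad (F := out_bit x tr (cells s2) C)) ?VC //.
move=> j k; rewrite /out_bit /tr_if.
by case: (tr); rewrite ?mxE (rep _ (rshift C _)) aug_r; case: (_ == 1)%R.
Qed.

(** * Copying a solution back *)

Definition base := Plus total (Var vK).

(* Cell 0 holds the flag telling whether the copied word is output: with [tr] the
   all-ones word is discarded. *)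
Definition copy_prog (tr : bool) :=
  Seq (header tr)
  (Seq (Sto (Cst 0) (Cst (~~ tr)))
  (Seq (ForLt vK vR (Seq (Wr (Letter base))
         (IfLt (Letter base) (Cst 1) (Sto (Cst 0) (Cst 1)) Skip)))
       (IfLt (Cst 0) (Deref (Cst 0)) Em Skip))).

(** The solution appended to a code, cut to as many letters as there are coordinates. Positions past
    the end would count as ones; the reductions only use words long enough. *)
Definition tail_word (tr : bool) (w : word) : word :=
  [seq input_letter w (code_size w + k) != 0
     | k <- iota 0 (if tr then cols_of w else rows_of w)].

Lemma copy_prog_spec tr x :
  souts (sem x (copy_prog tr) init_state) =
    if tr && all id (tail_word tr x) then [::] else [:: tail_word tr x].
Proof.
have [[VM VN VR VC VW] M0 B0 O0] := header_spec tr x.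
have leR : (if tr then cols_of x else rows_of x) <= size x.
  by case: (tr); rewrite ?rows_of_le ?cols_of_le.
set c3 := ForLt vK vR (Seq (Wr (Letter base))
  (IfLt (Letter base) (Cst 1) (Sto (Cst 0) (Cst 1)) Skip)).
set s0 := sem x (header tr) init_state in VM VN VR VC VW M0 B0 O0.
set s1 := sem x (Sto (Cst 0) (Cst (~~ tr))) s0.
have -> : sem x (copy_prog tr) init_state =
  if 0 < cells (sem x c3 s1) 0 then sem x Em (sem x c3 s1) else sem x c3 s1 by [].
have V1 : vars s1 = vars s0 by [].
pose bits k := [seq input_letter x (code_size x + k) != 0 | k <- iota 0 k].
have [Es EM] : sbuf (sem x c3 s1) = bits (vars s1 vR) /\
   cells (sem x c3 s1) 0 = ~~ (tr && all id (bits (vars s1 vR))).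
  apply: (@for_lt_ind x vK vR _ s1 (fun k h b => b = bits k /\
    h 0 = ~~ (tr && all id (bits k)))) => //.
  - by rewrite V1 VR.
  - by split; [exact: B0 | rewrite andbT].
  move=> k s2 lt_k Ek Hs2 [IH1 IH2].
  have Eb : eval x s2 base = code_size x + k.
    by rewrite /= Ek !Hs2 // V1 VM VN (minn_idPl (rows_of_le x)).
  set s3 := sem x (Wr (Letter base)) s2.
  have Eb3 : eval x s3 base = code_size x + k by [].
  have -> : sem x (Seq (Wr (Letter base)) (IfLt (Letter base) (Cst 1)
      (Sto (Cst 0) (Cst 1)) Skip)) s2 =
    if input_letter x (code_size x + k) < 1 then sem x (Sto (Cst 0) (Cst 1)) s3 else s3.
    by rewrite -Eb3.
  have B3 : sbuf s3 = bits k.+1.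
    by rewrite /bits iotaS_map -/(bits k) -IH1 -Eb.
  rewrite ltnS leqn0; split; first by case: ifP.
  rewrite /bits iotaS_map -/(bits k) all_rcons.
  case: eqP => /= nz; first by rewrite /upd /= andbF.
  by rewrite IH2.
rewrite V1 VR -/(tail_word tr x) in EM Es.
have O3 : souts (sem x c3 s1) = [::] by rewrite outs_frame.
set s3 := sem x c3 s1 in Es EM O3 *; clearbody s3.
by rewrite EM; case: (tr && _); rewrite /= O3 ?Es.
Qed.

Local Open Scope ring_scope.

(** * Circuits and minimal codewords *)

Definition supp n (c : 'rV['F_2]_n) : {set 'I_n} := [set i | c ord0 i == 1].

Lemma vec_leE n (u v : 'rV['F_2]_n) : vec_le u v = (supp u \subset supp v).
Proof. by []. Qed.

Lemma supp_inj n : injective (@supp n).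
Proof.
move=> u v /setP E; apply/rowP => i; have := E i; rewrite !inE => Ei.
by rewrite -(F2_eq1K (u 0 i)) -(F2_eq1K (v 0 i)) Ei.
Qed.

Lemma set_word_supp n (c : 'rV['F_2]_n) : set_word (supp c) = vec_word c.
Proof. by apply: eq_map => i; rewrite inE. Qed.

(** Coefficients of a relation among the rows in [D] and vectors of the left kernel supported in [D]
    correspond by extension by zero and restriction. *)
Lemma dependentP m n (M : 'M['F_2]_(m, n)) (D : {set 'I_m}) :
  reflect (exists c : 'rV['F_2]_m, [/\ c != 0, supp c \subset D & c *m M = 0])
          (~~ free [seq row i M | i in D]).
Proof.
pose X := [tuple row (enum_val i) M | i < #|D|].
have -> : [seq row i M | i in D] = X.
  apply: (@eq_from_nth _ 0) => [|i]; rewrite size_map -cardE ?size_tuple // => lt_i.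
  pose i' := Ordinal lt_i; rewrite -(tnth_nth 0 X i') tnth_mktuple.
  by rewrite (nth_map (enum_val i')) -?cardE // -(enum_val_nth _ i').
apply: (iffP idP).
  move=> nfree.
  suff /existsP[c /and3P[c0 cD /eqP cM]] : [exists c : 'rV['F_2]_m,
     [&& c != 0, supp c \subset D & c *m M == 0]] by exists c.
  apply: contraR nfree => /existsPn H; apply/freeP => k Hk i.
  (* [c] extends the coefficients [k] by zero outside [D]. *)
  pose c : 'rV_m := \sum_(i < #|D|) k i *: delta_mx 0 (enum_val i).
  have cE j : c 0 j = \sum_(i < #|D|) k i * (j == enum_val i)%:R.
    by rewrite summxE; apply: eq_bigr => l _; rewrite !mxE.
  have cM : c *m M == 0.
    rewrite mulmx_suml -[X in _ == X]Hk; apply/eqP/eq_bigr => l _.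
    by rewrite -scalemxAl -rowE /X -tnth_nth tnth_mktuple.
  have cD : supp c \subset D.
    apply/subsetP => j; rewrite inE cE; apply: contraTT => nj.
    rewrite big1 // => l _; case: eqP => [Ej|_]; rewrite ?mulr0 //.
    by rewrite Ej enum_valP in nj.
  have := H c; rewrite cD cM !andbT negbK => /eqP/rowP/(_ (enum_val i)).
  rewrite cE (bigD1 i) //= eqxx mulr1 big1 ?addr0 ?mxE // => l nl.
  by rewrite (inj_eq enum_val_inj) eq_sym (negbTE nl) mulr0.
move=> [c [c0 cD cM]]; apply: contra c0 => /freeP free.
have {free} : forall i : 'I_#|D|, c 0 (enum_val i) = 0.
  apply: (free (fun i => c 0 (enum_val i))).
  rewrite -[RHS]cM mulmx_sum_row [RHS](bigID (mem D)) [RHS]/=.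
  rewrite [X in _ + X]big1 ?addr0; last first.
    move=> j nj; have : j \notin supp c by apply: contra nj => /(subsetP cD).
    by rewrite inE -F2_neq0 negbK => /eqP ->; rewrite scale0r.
  rewrite [RHS]big_enum_val; apply: eq_bigr => i _.
  by rewrite -tnth_nth tnth_mktuple.
move=> H; apply/eqP/rowP => j; rewrite mxE; have [jD|nj] := boolP (j \in D).
  by have := H (enum_rank_in jD j); rewrite enum_rankK_in.
have : j \notin supp c by apply: contra nj => /(subsetP cD).
by rewrite inE -F2_neq0 negbK => /eqP.
Qed.

(** The common form of both problems: codewords of minimal nonzero support, with [V] a left kernel
    or a row space. *)
Definition min_nonzero n (V : 'rV['F_2]_n -> Prop) (v : 'rV['F_2]_n) : Prop :=
  [/\ v != 0, V v & forall u, u != 0 -> V u -> vec_le u v -> u = v].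

Lemma eq_min_nonzero n (V W : 'rV['F_2]_n -> Prop) v :
  (forall u, V u <-> W u) -> min_nonzero V v <-> min_nonzero W v.
Proof. by move=> VW; split=> -[v0 /VW Vv H]; split=> // u u0 /VW; exact: H. Qed.

(** Any nonzero dependency supported in a circuit has the whole circuit as its support, by
    minimality; over the two-element field the support determines it. *)
Lemma is_circuitP m n (M : 'M['F_2]_(m, n)) (C : {set 'I_m}) :
  is_circuit M C <-> exists2 c, min_nonzero (fun c => c *m M = 0) c & C = supp c.
Proof.
split=> [/minsetP[/dependentP[c [c0 cC cM]] minC]|[c [c0 cM minc] ->]].
  have dep d : d != 0 -> d *m M = 0 -> supp d \subset C -> supp d = C.
    by move=> d0 dM dC; apply: minC => //; apply/dependentP; exists d.
  have Ec := dep c c0 cM cC; exists c => //; split=> // u u0 uM.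
  by rewrite vec_leE Ec => /(dep u u0 uM) Eu; apply: supp_inj; rewrite Ec.
apply/minsetP; split; first by apply/dependentP; exists c.
move=> B /dependentP[d [d0 dB dM]] Bc.
have Ed : d = c by apply: minc => //; rewrite vec_leE (subset_trans dB).
by apply/eqP; rewrite eqEsubset Bc -Ed.
Qed.

Lemma circuit_solutionsP m n (M : 'M['F_2]_(m, n)) w :
  w \in circuit_solutions M <->
    exists2 c, min_nonzero (fun c => c *m M = 0) c & w = vec_word c.
Proof.
split=> [/imfsetP[C /=]|[c Hc ->]].
  by rewrite inE => /is_circuitP[c Hc ->] ->; exists c; rewrite ?set_word_supp.
apply/imfsetP; exists (supp c); last by rewrite set_word_supp.
by rewrite /= inE; apply/is_circuitP; exists c.
Qed.

(* The hypothesis is needed for [m = 0], where the closure is empty. *)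
Lemma Cl_L0_rows m n (M : 'M['F_2]_(m, n)) v : v != 0 ->
  (v \in Cl_L0 [set row i M | i : 'I_m]) = (v <= M)%MS.
Proof.
move=> v0; apply/idP/idP => [/bigcapP vC|/submxP[d Ev]].
  (* The row space is one of the closed sets containing the rows that are intersected. *)
  have := vC [set u | (u <= M)%MS]; rewrite inE; apply.
  apply/andP; split; first by apply/subsetP => _ /imsetP[i _ ->]; rewrite inE row_sub.
  apply/forall_inP => a aM; apply/forall_inP => b; move: aM; rewrite !inE.
  exact: addmx_sub.
apply/bigcapP => X /andP[/subsetP SX /forall_inP XX].
have X2 a b : a \in X -> b \in X -> a + b \in X by move=> /XX/forall_inP; apply.
have rX i : row i M \in X by apply: SX; apply: imset_f.
have X0 : 0 \in X.
  case: m M d Ev {SX} rX => [|m] M d Ev rX.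
    by case/eqP: v0; rewrite Ev (flatmx0 M) mulmx0.
  (* In characteristic two, a closed set containing some row contains 0 as the sum of that row with
     itself. *)
  rewrite (_ : 0 = row ord0 M + row ord0 M); first exact: X2.
  by apply/rowP => j; rewrite !mxE -mulr2n -mulr_natr pchar_Zp ?mulr0.
rewrite Ev mulmx_sum_row; apply: (big_ind (fun u => u \in X)) => // i _.
rewrite -(F2_eq1K (d 0 i)); case: eqP => _; first by rewrite scale1r.
by rewrite scale0r.
Qed.

(** Removing the all-ones vector before or after taking minimal elements is the same: every vector
    lies below it, so it never lies strictly below another one. *)
Lemma closure_min_solutionsP m n (M : 'M['F_2]_(m, n)) w :
  w \in closure_min_solutions M <-> exists2 v : 'rV['F_2]_n,
    [/\ v != const_mx 1 & min_nonzero (fun u => u <= M)%MS v] & w = vec_word v.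
Proof.
have inP v : v \in Cl_L0 [set row i M | i : 'I_m] :\: [set 0; const_mx 1] =
   [&& v != 0, v != const_mx 1 & (v <= M)%MS].
  rewrite !inE negb_or -andbA; have [->|v0] //= := eqVneq v 0.
  by rewrite Cl_L0_rows.
have le1 (u : 'rV['F_2]_n) : vec_le u (const_mx 1).
  by apply/subsetP => i _; rewrite inE mxE.
split=> [/imfsetP[v /=]|[v [v1 [v0 vM Hv]] ->]].
  rewrite inE inP => /andP[/and3P[v0 v1 vM] /forall_inP Hv] ->; exists v => //.
  split=> //; split=> // u u0 uM uv.
  have [u1|u1] := eqVneq u (const_mx 1).
    have : vec_le v u by rewrite u1.
    by rewrite vec_leE => vu; apply: supp_inj; apply/eqP; rewrite eqEsubset -vec_leE uv.
  by apply/eqP/(implyP (Hv u _)) => //; rewrite inP u0 u1.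
apply/imfsetP; exists v => //=; rewrite inE inP v0 v1 vM /=.
apply/forall_inP => u; rewrite inP => /and3P[u0 u1 uM]; apply/implyP => uv.
by apply/eqP; exact: Hv.
Qed.

(** * The programs on encoded families *)

Section EncodedInput.

Variables (m n : nat) (M : 'M['F_2]_(m, n)) (y : word).

Let rows := flatten [seq vec_word (row i M) | i <- enum 'I_m].

Lemma encode_cat : encode M ++ y =
  nseq m true ++ false :: (nseq n true ++ false :: (rows ++ y)).
Proof. by rewrite /encode -catA /= -catA. Qed.

Lemma rows_of_encode : rows_of (encode M ++ y) = m.
Proof. by rewrite /rows_of encode_cat index_nseq_cat. Qed.

Lemma cols_of_encode : cols_of (encode M ++ y) = n.
Proof.
by rewrite /cols_of rows_of_encode encode_cat drop_nseq_cat index_nseq_cat.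
Qed.

Lemma code_size_encode : code_size (encode M ++ y) = size (encode M).
Proof.
rewrite /code_size rows_of_encode cols_of_encode /encode.
by rewrite !size_cat /= size_cat /= !size_nseq size_rows; lia.
Qed.

Lemma input_letter_encode (i : 'I_m) (j : 'I_n) :
  input_letter (encode M ++ y) (m + n + 2 + (i * n + j)) = (M i j == 1).
Proof.
have lt_ij : (i * n + j < m * n)%N.
  by have := ltn_ord i; have := ltn_ord j; nia.
rewrite /input_letter encode_cat !size_cat /= !size_cat /= size_cat !size_nseq size_rows.
rewrite ifT; last by lia.
rewrite nth_cat size_nseq ifF; last by lia.
rewrite (_ : (_ - m = (n + (i * n + j).+1).+1)%N); last by lia.
rewrite /= nth_cat size_nseq ifF; last by lia.
rewrite (_ : (_ - n = (i * n + j).+1)%N) /=; last by lia.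
by rewrite nth_cat size_rows lt_ij nth_rows.
Qed.

(** The appended word may be longer than needed, which lets the copy cut off a padding
    coordinate. *)
Lemma tail_word_encode tr : (size y >= if tr then n else m)%N ->
  tail_word tr (encode M ++ y) = take (if tr then n else m) y.
Proof.
move=> le_y; rewrite /tail_word rows_of_encode cols_of_encode code_size_encode.
set r := if tr then n else m; apply: (@eq_from_nth _ false).
  by rewrite size_map size_iota size_takel.
rewrite size_map size_iota => k lt_k.
rewrite (nth_map 0%N) ?size_iota // nth_iota // add0n nth_take //.
rewrite /input_letter size_cat ltn_add2l (leq_trans lt_k) //.
by rewrite nth_cat ltnNge leq_addr /= addKn; case: nth.
Qed.

End EncodedInput.

(** The reduction map is read off the program, which outputs exactly one word on every input. *)
Definition kernel_word (tr : bool) (x : word) : word :=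
  head [::] (souts (sem x (kernel_prog tr) init_state)).

Lemma kernel_word_None tr x : decode x = None -> kernel_word tr x = [::].
Proof. by rewrite /kernel_word => /(kernel_prog_None tr) ->. Qed.

(** The rows of [G] generate the orthogonal of the row space of [M]. The family written consists of
    the columns of [G], each followed by a zero. *)
Lemma kernel_prog_tr m n (M : 'M['F_2]_(m, n)) :
  exists G : 'M['F_2]_n,
    [/\ G *m M^T = 0, forall c : 'rV['F_2]_n, c *m M^T = 0 -> exists d, c = d *m G
      & souts (sem (encode M) (kernel_prog true) init_state) =
          [:: encode (row_mx G^T (0 : 'M_(n, 1)))]].
Proof.
apply: (@kernel_prog_spec true _ n m M^T).
- by have := code_size_encode M [::]; rewrite cats0.
- by have := cols_of_encode M [::]; rewrite cats0.
- by have := rows_of_encode M [::]; rewrite cats0.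
move=> j k; have := input_letter_encode M [::] k j.
have := rows_of_encode M [::]; have := cols_of_encode M [::].
by rewrite cats0 => -> -> E; rewrite mxE -E.
Qed.

Lemma kernel_prog_id m n (M : 'M['F_2]_(m, n)) :
  exists G : 'M['F_2]_m,
    [/\ G *m M = 0, forall c : 'rV['F_2]_m, c *m M = 0 -> exists d, c = d *m G
      & souts (sem (encode M) (kernel_prog false) init_state) =
          [:: encode (row_mx G (0 : 'M_(m, 1)))]].
Proof.
apply: (@kernel_prog_spec false _ m n M).
- by have := code_size_encode M [::]; rewrite cats0.
- by have := rows_of_encode M [::]; rewrite cats0.
- by have := cols_of_encode M [::]; rewrite cats0.
move=> j k; have := input_letter_encode M [::] j k.
have := rows_of_encode M [::]; have := cols_of_encode M [::].
by rewrite cats0 => -> -> E; rewrite -E.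
Qed.

Lemma kernel_word_polytime tr : polytime (kernel_word tr).
Proof.
apply: (@polytime_cmd (kernel_prog tr)) => x; rewrite /kernel_word.
case E : (decode x) => [F|]; last by rewrite (kernel_prog_None tr E).
rewrite (decodeK E); case: tr.
  by have [G [_ _ ->]] := kernel_prog_tr (tagged F).
by have [G [_ _ ->]] := kernel_prog_id (tagged F).
Qed.

(** Each solution of the target problem yields at most one solution of the source, so the
    disjointness required of a reduction amounts to injectivity. *)
Definition copy_tail (tr : bool) : enum_problem := fun w =>
  if tr && all id (tail_word tr w) then fset0 else [fset tail_word tr w]%fset.

Lemma copy_tail_poly_delay tr : poly_delay (copy_tail tr).
Proof.
apply: (@poly_delay_cmd (copy_prog tr)) => x; rewrite copy_prog_spec; first by case: ifP.
by move=> w; rewrite /copy_tail; case: ifP => _; rewrite ?inE.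
Qed.

(* Double orthogonality: the dependencies among the columns of a generator
   matrix of the orthogonal of the row space of [M] form that row space. *)
Lemma dependencies_kernel m n (M : 'M['F_2]_(m, n)) (G : 'M['F_2]_n) :
    G *m M^T = 0 -> (forall c : 'rV_n, c *m M^T = 0 -> exists d, c = d *m G) ->
  forall c : 'rV_n, c *m row_mx G^T (0 : 'M_(n, 1)) = 0 <-> (c <= M)%MS.
Proof.
move=> GM ker c; rewrite mul_mx_row mulmx0 -row_mx0; split.
  (* The columns of [cokermx M] are orthogonal to the rows of [M], hence combinations of rows of
     [G]. A dependency [c] among the columns of [G] thus annihilates [cokermx M], which
     characterizes the row space of [M]. *)
  move=> /eq_row_mx[cG _]; have /submxP[D ED] : ((cokermx M)^T <= G)%MS.
    apply/row_subP => i; have [|d ->] := ker (row i (cokermx M)^T); last exact: submxMl.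
    by rewrite -row_mul -trmx_mul mulmx_coker trmx0 row0.
  by rewrite submxE -[cokermx M]trmxK ED trmx_mul mulmxA cG mul0mx.
move=> /submxP[d ->]; congr row_mx.
by rewrite -mulmxA -[M]trmxK -trmx_mul GM trmx0 mulmx0.
Qed.

(** The row space of [G] is the left kernel of [M]; padding every row with a zero gives an
    isomorphic code. *)
Lemma rowspan_kernel m n (M : 'M['F_2]_(m, n)) (G : 'M['F_2]_m) :
    G *m M = 0 -> (forall c : 'rV_m, c *m M = 0 -> exists d, c = d *m G) ->
  forall v : 'rV_(m + 1), (v <= row_mx G (0 : 'M_(m, 1)))%MS <->
    exists2 c, c *m M = 0 & v = row_mx c 0.
Proof.
move=> GM ker v; split=> [/submxP[d ->]|[c /ker[d ->] ->]].
  by exists (d *m G); rewrite ?mul_mx_row ?mulmx0 // -mulmxA GM mulmx0.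
by rewrite -[X in row_mx _ X](mulmx0 _ d) -mul_mx_row submxMl.
Qed.

Lemma vec_word_all n (v : 'rV['F_2]_n) : all id (vec_word v) = (v == const_mx 1).
Proof.
apply/allP/eqP => [H|-> b /mapP[i _ ->]]; last by rewrite mxE.
apply/rowP => i; rewrite mxE; apply/eqP/(H (v 0 i == 1)).
by apply/mapP; exists i; rewrite ?mem_enum.
Qed.

Lemma vec_word_pad n (c : 'rV['F_2]_n) :
  vec_word (row_mx c (0 : 'M_1)) = rcons (vec_word c) false.
Proof.
apply: (@eq_from_nth _ false); first by rewrite size_rcons !size_vec_word addn1.
rewrite size_vec_word => k lt_k; rewrite (nth_vec_word _ (Ordinal lt_k)) nth_rcons.
rewrite size_vec_word mxE; case: splitP => k' /= Ek.
  by rewrite Ek ltn_ord nth_vec_word.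
by rewrite mxE Ek ltnNge leq_addr /= if_same.
Qed.

Lemma vec_le_pad n (u v : 'rV['F_2]_n) :
  vec_le (row_mx u (0 : 'M_1)) (row_mx v 0) = vec_le u v.
Proof.
rewrite !vec_leE; apply/subsetP/subsetP => H i.
  by have := H (lshift 1 i); rewrite !inE !row_mxEl.
rewrite !inE; case: (split_ordP i) => j ->; rewrite ?row_mxEl ?row_mxEr ?mxE //.
by have := H j; rewrite !inE.
Qed.

(** * The two reductions *)

(** The circuits of the computed family are the minimal codewords of the row space; its zero column
    leaves the dependencies unchanged. Copying returns each codeword itself and drops the all-ones
    one. *)
Lemma closure_min_to_circuits : pd_reducible EnumClosureMin_L0 EnumBinaryMatroidCircuits.
Proof.
exists (kernel_word true), (copy_tail true); split.
- exact: kernel_word_polytime.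
- exact: copy_tail_poly_delay.
move=> x; case E : (decode x) => [F|]; last first.
  (* A word encoding no family is mapped to the empty word, which encodes none either, so both sides
     are empty. *)
  rewrite /EnumClosureMin_L0 /family_problem E (kernel_word_None true E) /=.
  by split=> //; rewrite [RHS]big_nil.
rewrite (decodeK E); case: F {E} => -[m n] /= M.
have [G [GM ker outG]] := kernel_prog_tr M.
have -> : EnumBinaryMatroidCircuits (kernel_word true (encode M)) =
    circuit_solutions (row_mx G^T (0 : 'M_(n, 1))).
  by rewrite /kernel_word outG /= /EnumBinaryMatroidCircuits /family_problem encodeK.
have -> : EnumClosureMin_L0 (encode M) = closure_min_solutions M.
  by rewrite /EnumClosureMin_L0 /family_problem encodeK.
have copyE (c : 'rV_n) : copy_tail true (encode M ++ vec_word c) =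
    if c == const_mx 1 then fset0 else [fset vec_word c]%fset.
  rewrite /copy_tail tail_word_encode ?size_vec_word //.
  by rewrite take_oversize ?size_vec_word // vec_word_all.
have solP w : w \in circuit_solutions (row_mx G^T (0 : 'M_(n, 1))) <->
    exists2 c, min_nonzero (fun c => c <= M)%MS c & w = vec_word c.
  have EV := dependencies_kernel GM ker.
  rewrite circuit_solutionsP; split=> -[c Hc ->]; exists c => //;
    by apply/(eq_min_nonzero _ EV).
split.
  move=> _ _ /solP[c _ ->] /solP[d _ ->] neq; rewrite !copyE.
  apply/fsetP => w; rewrite !inE; apply/negP => /andP[].
  by do 2 case: ifP => _; rewrite !inE // => /eqP -> /eqP E; rewrite E eqxx in neq.
apply/fsetP => w; apply/idP/bigfcupP.
  move=> /closure_min_solutionsP[v [v1 Hv] ->]; exists (vec_word v).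
    by rewrite andbT; apply/solP; exists v.
  by rewrite copyE (negbTE v1) inE.
move=> [_ /andP[/solP[c Hc ->] _]]; rewrite copyE; case: eqVneq => // c1.
by rewrite inE => /eqP ->; apply/closure_min_solutionsP; exists c.
Qed.

(** The computed family spans a copy of the space of dependencies, with a zero coordinate appended.
    The all-ones vector is therefore not in it, and copying removes the extra coordinate. *)
Lemma circuits_to_closure_min : pd_reducible EnumBinaryMatroidCircuits EnumClosureMin_L0.
Proof.
exists (kernel_word false), (copy_tail false); split.
- exact: kernel_word_polytime.
- exact: copy_tail_poly_delay.
move=> x; case E : (decode x) => [F|]; last first.
  rewrite /EnumBinaryMatroidCircuits /family_problem E (kernel_word_None false E) /=.
  by split=> //; rewrite [RHS]big_nil.
rewrite (decodeK E); case: F {E} => -[m n] /= M.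
have [G [GM ker outG]] := kernel_prog_id M.
have -> : EnumClosureMin_L0 (kernel_word false (encode M)) =
    closure_min_solutions (row_mx G (0 : 'M_(m, 1))).
  by rewrite /kernel_word outG /= /EnumClosureMin_L0 /family_problem encodeK.
have -> : EnumBinaryMatroidCircuits (encode M) = circuit_solutions M.
  by rewrite /EnumBinaryMatroidCircuits /family_problem encodeK.
have copyE (c : 'rV_m) : copy_tail false (encode M ++ rcons (vec_word c) false) =
    [fset vec_word c]%fset :> {fset word}.
  rewrite /copy_tail tail_word_encode; last by rewrite size_rcons size_vec_word.
  by rewrite -cats1 take_size_cat ?size_vec_word.
have solP w : w \in closure_min_solutions (row_mx G (0 : 'M_(m, 1))) <->
    exists2 c, min_nonzero (fun c => c *m M = 0) c & w = rcons (vec_word c) false.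
  have EV := rowspan_kernel GM ker.
  rewrite closure_min_solutionsP; split.
    move=> [v [_ [v0 /EV[c cM Ev] Hv]] ->]; exists c; last by rewrite Ev vec_word_pad.
    split=> //; first by apply: contra v0 => /eqP c0; rewrite Ev c0 row_mx0.
    move=> u u0 uM uc; suff /eq_row_mx[] : row_mx u 0 = row_mx c (0 : 'M_1) by [].
    rewrite -Ev; apply: Hv.
    - by apply: contra u0 => /eqP; rewrite -row_mx0 => /eq_row_mx[->].
    - by apply/EV; exists u.
    - by rewrite Ev vec_le_pad.
  move=> [c [c0 cM Hc] ->]; exists (row_mx c 0); last by rewrite vec_word_pad.
  split; last split.
  (* The appended coordinate is 0, which excludes the all-ones vector. *)
  - apply/eqP => /rowP/(_ (rshift m ord0)); rewrite row_mxEr !mxE => /eqP.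
    by rewrite eq_sym oner_eq0.
  - by apply: contra c0 => /eqP; rewrite -row_mx0 => /eq_row_mx[->].
  - by apply/EV; exists c.
  move=> v v0 /EV[u uM Ev]; rewrite Ev vec_le_pad => uc.
  rewrite (Hc u) //; apply: contra v0 => /eqP u0.
  by rewrite Ev u0 row_mx0.
split.
  move=> _ _ /solP[c _ ->] /solP[d _ ->] neq; rewrite !copyE.
  apply/fsetP => w; rewrite !inE; apply/negP => /andP[/eqP -> /eqP E].
  by rewrite E eqxx in neq.
apply/fsetP => w; apply/idP/bigfcupP.
  move=> /circuit_solutionsP[c Hc ->]; exists (rcons (vec_word c) false).
    by rewrite andbT; apply/solP; exists c.
  by rewrite copyE inE.
move=> [_ /andP[/solP[c Hc ->] _]]; rewrite copyE inE => /eqP ->.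
by apply/circuit_solutionsP; exists c.
Qed.

Theorem theorem37 : pd_equivalent EnumClosureMin_L0 EnumBinaryMatroidCircuits.
Proof. by split; [exact: closure_min_to_circuits | exact: circuits_to_closure_min]. Qed.
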